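(* The consistency problem for Elementary Probability is decidable: there is a procedure which, given any elementary-probability pre-environment (that is, $n$, boolean combinations $B_1,\dots,B_k$ of $A_1,\dots,A_n$, and a finite list of polynomial requirements $g_r(P(B_1),\dots,P(B_k))\triangleleft_r 0$, $r\in R$), decides in a finite number of steps whether it is consistent, i.e. whether it determines a probability environment.
   Context: A basic probability space is a triple $(\overline\Omega,\overline{\mathbb A},\overline P)$ where $\overline\Omega$ is a set, $\overline{\mathbb A}$ is a family of subsets of $\overline\Omega$ containing $\emptyset$ and $\overline\Omega$, and $\overline P:\overline{\mathbb A}\to\mathbb R$ satisfies $\overline P(\emptyset)=0$, $\overline P(\overline\Omega)=1$, and $\overline P(\overline A)\le\overline P(\overline B)$ whenever $\overline A\subseteq\overline B$ are in $\overline{\mathbb A}$. An elementary-probability pre-environment consists of: event symbols $A_1,\dots,A_n$; boolean combinations $B_1,\dots,B_k$ of $A_1,\dots,A_n$; a finite index set $R$; and, for each $r\in R$, a polynomial $g_r(x_1,\dots,x_k)=\sum_{0\le\rho_1,\dots,\rho_k\le s}a_{\rho_1,\dots,\rho_k}(r)\prod_{j=1}^k x_j^{\rho_j}$ with real coefficients and a relation $\triangleleft_r\in\{=,\neq,\ge\}$. Its requirements are $g_r(P(B_1),\dots,P(B_k))\triangleleft_r 0$ for $r\in R$, together with the requirement that all finite collections of events are jointly perceivable, i.e. the family of events is an algebra and $P$ is finitely additive on it. It is consistent (determines a probability environment) if there are a basic probability space $(\overline\Omega,\overline{\mathbb A},\overline P)$ with $\overline{\mathbb A}$ an algebra and $\overline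 P$ finitely additive, and events $\overline A_1,\dots,\overline A_n\in\overline{\mathbb A}$, such that $g_r(\overline P(\overline B_1),\dots,\overline P(\overline B_k))\triangleleft_r 0$ for all $r\in R$, where $\overline B_j$ is $B_j$ evaluated at $\overline A_1,\dots,\overline A_n$. Since the coefficients are real numbers, ''decidable in a finite number of steps'' is meant in the sense of Tarski-Seidenberg elimination: the steps are arithmetic operations and sign tests on the coefficients. *)

(* Defs.v *)
From HB Require Import structures.
From mathcomp Require Import all_boot all_order all_algebra.
From mathcomp Require Import boolp classical_sets reals.

Set Implicit Arguments.
Unset Strict Implicit.
Unset Printing Implicit Defensive.

Import Order.TTheory GRing.Theory Num.Theory.
Local Open Scope classical_set_scope.
Local Open Scope ring_scope.

(* For n > 0 the constants are definable from the event symbols; they only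
   matter for n = 0. *)
Inductive boolean_combination (n : nat) : Type :=
| BVar of 'I_n
| BNot of boolean_combination n
| BAnd of boolean_combination n & boolean_combination n
| BOr of boolean_combination n & boolean_combination n
| BTrue
| BFalse.

Arguments BTrue {n}.
Arguments BFalse {n}.

Fixpoint event n (Omega : Type) (A : 'I_n -> set Omega)
    (B : boolean_combination n) : set Omega :=
  match B with
  | BVar i => A i
  | BNot B1 => ~` event A B1
  | BAnd B1 B2 => event A B1 `&` event A B2
  | BOr B1 B2 => event A B1 `|` event A B2
  | BTrue => setT
  | BFalse => set0
  end.

Variant relation0 := EqZero | NeqZero | GeqZero.

Definition holds0 (R : realType) (rel : relation0) (x : R) : Prop :=
  match rel with
  | EqZero => x = 0
  | NeqZero => x <> 0
  | GeqZero => 0 <= x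
  end.

(* The polynomial g(x_1, ..., x_k) is given by its array of coefficients
   a_rho, where rho ranges over all exponent vectors with entries in
   {0, ..., s}. *)
Record requirement (R : realType) (k s : nat) := Requirement {
  coefficient : {ffun 'I_k -> 'I_s.+1} -> R;
  req_relation : relation0
}.

Definition polynomial_value (R : realType) k s (g : requirement R k s)
    (x : 'I_k -> R) : R :=
  \sum_(rho : {ffun 'I_k -> 'I_s.+1})
    coefficient g rho * \prod_(j < k) x j ^+ rho j.

Record pre_environment (R : realType) := PreEnvironment {
  num_events : nat;
  num_combinations : nat;
  degree_bound : nat;
  combination : 'I_num_combinations -> boolean_combination num_events;
  num_requirements : nat;
  requirement_at :
    'I_num_requirements -> requirement R num_combinations degree_bound
}.

(* P : AA -> R is represented by a function on all subsets of Omega of which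
   only the values on AA are ever constrained or used. *)
Definition basic_probability_space (R : realType) (Omega : Type)
    (AA : set (set Omega)) (P : set Omega -> R) : Prop :=
  [/\ AA set0, AA setT, P set0 = 0, P setT = 1 &
      forall A B, AA A -> AA B -> A `<=` B -> P A <= P B].

Definition algebra_of_sets (Omega : Type) (AA : set (set Omega)) : Prop :=
  [/\ AA set0, forall A, AA A -> AA (~` A) & setU_closed AA].

Definition finitely_additive (R : realType) (Omega : Type)
    (AA : set (set Omega)) (P : set Omega -> R) : Prop :=
  forall A B, AA A -> AA B -> A `&` B = set0 -> P (A `|` B) = P A + P B.

Definition consistent (R : realType) (E : pre_environment R) : Prop :=
  exists (Omega : Type) (AA : set (set Omega)) (P : set Omega -> R)
         (A : 'I_(num_events E) -> set Omega),
    [/\ basic_probability_space AA P,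
        algebra_of_sets AA,
        finitely_additive AA P,
        forall i, AA (A i) &
        forall r : 'I_(num_requirements E),
          holds0 (req_relation (requirement_at r))
            (polynomial_value (requirement_at r)
               (fun j => P (event A (combination j))))].

(* A stack machine for a call-by-value functional language over finite trees
   with real leaves.  The type [instr] does not mention R: no real constant
   other than 1 can be built into a program, so that the input is the only
   source of real numbers. *)
Inductive instr : Type :=
| I_Var of nat
| I_One
| I_Add | I_Opp | I_Mul | I_Inv
| I_Pos of seq instr & seq instr
| I_Nil | I_Cons
| I_Case of seq instr & seq instr
| I_Fun of seq instr
| I_App.

Definition program := seq instr.

Inductive value (R : realType) : Type :=
| VReal of R
| VNil
| VCons of value R & value R
| VFun of program & seq (value R).

Arguments VNil {R}.
Arguments VFun {R}.

Record state (R : realType) := State {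
  code : program;
  env : seq (value R);
  stack : seq (value R);
  (* suspended code, each with the environment to be restored *)
  frames : seq (program * seq (value R))
}.

Arguments State {R}.

(* One step performs at most one arithmetic operation or one sign test.
   [None] means that the machine is halted or stuck.  The body of a called
   function finds its argument at index 0, itself at index 1, and the
   environment of its definition from index 2 on. *)
Definition step (R : realType) (st : state R) : option (state R) :=
  let: State c e s f := st in
  match c, s with
  | I_Var i :: c', _ =>
      if onth e i is Some v then Some (State c' e (v :: s) f) else None
  | I_One :: c', _ => Some (State c' e (VReal 1 :: s) f)
  | I_Add :: c', VReal y :: VReal x :: s' =>
      Some (State c' e (VReal (x + y) :: s') f)
  | I_Opp :: c', VReal x :: s' => Some (State c' e (VReal (- x) :: s') f)
  | I_Mul :: c', VReal y :: VReal x :: s' =>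
      Some (State c' e (VReal (x * y) :: s') f)
  | I_Inv :: c', VReal x :: s' => Some (State c' e (VReal x^-1 :: s') f)
  | I_Pos c1 c2 :: c', VReal x :: s' =>
      Some (State (if 0 < x then c1 else c2) e s' ((c', e) :: f))
  | I_Nil :: c', _ => Some (State c' e (VNil :: s) f)
  | I_Cons :: c', w :: v :: s' => Some (State c' e (VCons v w :: s') f)
  | I_Case c1 c2 :: c', VNil :: s' => Some (State c1 e s' ((c', e) :: f))
  | I_Case c1 c2 :: c', VCons v w :: s' =>
      Some (State c2 (v :: w :: e) s' ((c', e) :: f))
  | I_Fun b :: c', _ => Some (State c' e (VFun b e :: s) f)
  | I_App :: c', v :: VFun b e' :: s' =>
      Some (State b (v :: VFun b e' :: e') s' ((c', e) :: f))
  | [::], _ =>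
      if f is (c', e') :: f' then Some (State c' e' s f') else None
  | _, _ => None
  end.

(* The number m of steps is not bounded in advance.  The final state has no
   successor, so that each input has at most one output. *)
Definition outputs (R : realType) (p : program) (x v : value R) : Prop :=
  exists (m : nat) (e : seq (value R)),
    iter m (obind (@step R)) (Some (State p [:: x] [::] [::]))
    = Some (State [::] e [:: v] [::]).

Definition list_value (R : realType) (vs : seq (value R)) : value R :=
  foldr (@VCons R) VNil vs.

Definition nat_value (R : realType) (m : nat) : value R :=
  list_value (nseq m VNil).

Arguments nat_value {R}.

Definition bool_value (R : realType) (b : bool) : value R := nat_value b.

Fixpoint combination_value (R : realType) n (B : boolean_combination n) :
    value R :=
  match B with
  | BVar i => list_value [:: nat_value 0; nat_value i]
  | BNot B1 => list_value [:: nat_value 1; combination_value R B1]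
  | BAnd B1 B2 => list_value
      [:: nat_value 2; combination_value R B1; combination_value R B2]
  | BOr B1 B2 => list_value
      [:: nat_value 3; combination_value R B1; combination_value R B2]
  | BTrue => list_value [:: nat_value 4]
  | BFalse => list_value [:: nat_value 5]
  end.

Definition relation_value (R : realType) (rel : relation0) : value R :=
  match rel with
  | EqZero => nat_value 0
  | NeqZero => nat_value 1
  | GeqZero => nat_value 2
  end.

(* The relation, followed by all monomials a_rho * x^rho, each given as
   a_rho followed by the list of the exponents rho_1, ..., rho_k. *)
Definition requirement_value (R : realType) k s (g : requirement R k s) :
    value R :=
  VCons (relation_value R (req_relation g))
    (list_value
       [seq VCons (VReal (coefficient g rho))
              (list_value [seq nat_value (rho j) | j : 'I_k])
       | rho : {ffun 'I_k -> 'I_s.+1}]).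

Definition pre_environment_value (R : realType) (E : pre_environment R) :
    value R :=
  list_value
    [:: nat_value (num_events E);
        nat_value (num_combinations E);
        nat_value (degree_bound E);
        list_value [seq combination_value R (combination j)
                   | j : 'I_(num_combinations E)];
        list_value [seq requirement_value (requirement_at r)
                   | r : 'I_(num_requirements E)]].

(* A single program decides Q on all inputs x : I, presented to the machine
   as the trees [encode x]. *)
Definition decidable_problem (R : realType) (I : Type) (encode : I -> value R)
    (Q : I -> Prop) : Prop :=
  exists p : program, forall x : I,
    exists b : bool, (b <-> Q x) /\ outputs p (encode x) (bool_value R b).

(* Main.v *)
(* A pre-environment is consistent iff there are real numbers p_w, one for each
   of the 2^n valuations w of the events, with p_w >= 0 and sum 1, that satisfy
   the requirements when each P(B_j) is replaced by the sum of the p_w over the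
   valuations w that make B_j true.

   Whether such numbers exist is decided by the Cohen-Hormander elimination
   method: the list of all sign vectors that given polynomials realize on R^N is
   computed by recursion on N.  View the polynomials as univariate over the ring
   of polynomials in the other N - 1 variables and close them under truncation,
   derivative and pseudo-remainder.  The signs of all coefficients at a point of
   R^(N-1) then determine the sign table along the line above that point: the
   polynomials enter the table by increasing degree, the sign of a new one at a
   root of an earlier one is the sign of a remainder, and between two consecutive
   roots its derivative has no zero.

   A function on finite data is computable if some program computes it on the
   encodings; such functions are closed under composition and under structural
   recursion, which covers the decision procedure. *)

Require Import Defs.
From HB Require Import structures.
From mathcomp Require Import all_boot all_order all_algebra.
From mathcomp Require Import boolp classical_sets reals.
From mathcomp Require Import polyrcf lra ring.

Set Implicit Arguments.
Unset Strict Implicit.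
Unset Printing Implicit Defensive.

Import Order.TTheory GRing.Theory Num.Theory.
Local Open Scope ring_scope.

(** * Signs of a polynomial on an interval *)

(** The recursion on N carries the list of all realizable sign vectors, not the truth of one
    formula: the step for N needs every sign pattern of a larger set of polynomials on R^(N-1), and
    with the full list at hand the final decision is a mere scan. Only the signs of coefficients at
    a base point are known, never the point. A formal leading coefficient may therefore vanish, and
    the true degree varies from fibre to fibre. This is why the closure contains truncations, and
    why a polynomial enters a table only if its formal leading coefficient is nonzero at the base
    point. It is also why remainders use multiplication only: division would need a case distinction
    already at the level of polynomials. Signs are found by searching for a polynomial in a list, so
    the procedure compares polynomials for equality. Since coefficients are real, such a comparison
    is itself made of sign tests. The machine knows neither dependent types nor proofs. The
    procedure is therefore a function on plain lists, numbers and trees, arranged so that the plain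
    copy of a pre-environment has the very encoding that the problem prescribes. *)

Section SignBetween.
Variable R : rcfType.
Implicit Types (p : {poly R}) (a b c x : R).

Definition sign_at_left p (lo : option R) (s : R) : Prop :=
  if lo is Some a then Num.sg p.[a] = s
  else exists B, forall x, x <= B -> Num.sg p.[x] = s.

Definition sign_at_right p (hi : option R) (s : R) : Prop :=
  if hi is Some b then Num.sg p.[b] = s
  else exists B, forall x, B <= x -> Num.sg p.[x] = s.

Definition above (lo : option R) x : bool := if lo is Some a then a < x else true.
Definition below (hi : option R) x : bool := if hi is Some b then x < b else true.
Definition between (lo hi : option R) x : Prop := above lo x /\ below hi x.

(** The derivative of a constant vanishes everywhere, so nonzero constants need a clause of their
    own. *)
Definition monotone_on p (lo hi : option R) : Prop :=
  (exists2 c, c != 0 & p = c%:P) \/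
  (forall x, between lo hi x -> p^`().[x] != 0).

Lemma sign_at_pinfty p : p != 0 -> sign_at_right p None (Num.sg (lead_coef p)).
Proof.
move=> p0; have [lp|lp] := ltrP 0 (lead_coef p).
  have [B HB] := poly_pinfty_gt_lc lp; exists B => x /HB Hx.
  by rewrite !gtr0_sg //; apply: lt_le_trans Hx.
have lp' : 0 < lead_coef (- p).
  by rewrite lead_coefN oppr_gt0 lt_neqAle lead_coef_eq0 p0.
have [B HB] := poly_pinfty_gt_lc lp'; exists B => x /HB; rewrite hornerN => Hx.
have := lt_le_trans lp' Hx; rewrite oppr_gt0 => ?.
by rewrite !ltr0_sg // -oppr_gt0 -lead_coefN.
Qed.

(** Reduces to plus infinity through the composition of [p] with [- 'X], whose leading coefficient
    picks up the parity of the degree. *)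
Lemma sign_at_minfty p : p != 0 ->
  sign_at_left p None (Num.sg (lead_coef p) * (-1) ^+ (size p).-1).
Proof.
move=> p0; have q0 : p \Po - 'X != 0.
  apply: contraNneq p0 => /(congr1 (comp_poly (- 'X))).
  rewrite comp_poly0 -comp_polyA comp_polyE.
  by move=> <-; rewrite raddfN /= comp_polyX opprK -comp_polyE comp_polyXr.
have [B HB] := sign_at_pinfty q0; exists (- B) => x xB.
have := HB (- x); rewrite horner_comp !hornerE opprK => ->; last by rewrite lerNr.
rewrite lead_coef_comp ?size_polyN ?size_polyX // lead_coefN lead_coefX.
by rewrite sgrM sgrX sgrN1.
Qed.

Lemma sign_between_finite p a b x :
  monotone_on p (Some a) (Some b) -> a < x -> x < b ->
  ~~ (Num.sg p.[a] * Num.sg p.[b] < 0) ->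
  p.[x] != 0 /\
  Num.sg p.[x] = if Num.sg p.[a] == 0 then Num.sg p.[b] else Num.sg p.[a].
Proof.
move=> [[c c0 ->]|der] ax xb; first by rewrite !hornerC sgr_eq0 (negPf c0).
have ab := lt_trans ax xb.
have der' : {in `]a, b[, forall y, ~~ root p^`() y}.
  by move=> y; rewrite in_itv /= => /andP[ay yb]; apply: der.
have Ia : a \in `[a, b] by rewrite in_itv /= lexx ltW.
have Ib : b \in `[a, b] by rewrite in_itv /= lexx ltW.
have Ix : x \in `[a, b] by rewrite in_itv /= !ltW.
(* The values at the two ends and at [x] are compared pairwise. The split below is on the direction
   of monotonicity; sign patterns that contradict the order of the values drop out. *)
have := lgtr_horner ab der' Ia Ix; have := lgtr_horner ab der' Ix Ib.
have := lgtr_horner ab der' Ix Ia; have := lgtr_horner ab der' Ib Ix.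
case: (_ < 0) => /=; rewrite ?expr0 ?expr1 ?mul1r ?mulN1r ?ltrN2 ax xb;
  rewrite ?(lt_gtF ax) ?(lt_gtF xb);
by do 3?case: sgrP; move=> * //; split; rewrite ?eqxx ?oner_eq0 ?oppr_eq0 ?oner_eq0 //; lra.
Qed.

(** Trades a possibly infinite end for a finite point with the same sign, so that unbounded
    intervals need no separate argument. *)
Lemma sign_at_left_near p lo s x :
  sign_at_left p lo s -> above lo x ->
  exists a, [/\ a < x, Num.sg p.[a] = s &
    forall y, a < y -> above lo y].
Proof.
case: lo => [a|] /=; first by exists a.
move=> [B HB] _; exists (Num.min B (x - 1)); split => //.
  by rewrite gt_min ltrBlDr ltrDl ltr01 orbT.
by apply: HB; rewrite ge_min lexx.
Qed.

Lemma sign_at_right_near p hi s x :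
  sign_at_right p hi s -> below hi x ->
  exists b, [/\ x < b, Num.sg p.[b] = s &
    forall y, y < b -> below hi y].
Proof.
case: hi => [b|] /=; first by exists b.
move=> [B HB] _; exists (Num.max B (x + 1)); split => //.
  by rewrite lt_max ltrDl ltr01 orbT.
by apply: HB; rewrite le_max lexx.
Qed.

Lemma monotone_on_sub p lo hi lo' hi' :
  (forall x, between lo' hi' x -> between lo hi x) ->
  monotone_on p lo hi -> monotone_on p lo' hi'.
Proof. by move=> sub [?|H]; [left | right => x /sub/H]. Qed.

Lemma sign_between p lo hi sa sb x :
  monotone_on p lo hi -> sign_at_left p lo sa -> sign_at_right p hi sb ->
  ~~ (sa * sb < 0) -> between lo hi x ->
  p.[x] != 0 /\ Num.sg p.[x] = if sa == 0 then sb else sa.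
Proof.
move=> mono Ha Hb sab [lox xhi].
have [a [ax sa_a Sa]] := sign_at_left_near Ha lox.
have [b [xb sb_b Sb]] := sign_at_right_near Hb xhi.
rewrite -sa_a -sb_b in sab *; apply: sign_between_finite => //.
by apply: monotone_on_sub mono => y [/= /Sa ? /Sb ?].
Qed.

(** The intermediate value theorem supplies [c]. Seen from either half, [c] is an end with sign 0,
    so the product of the end signs is 0 and [sign_between] applies to each half. *)
Lemma sign_between_split p lo hi sa sb x0 :
  monotone_on p lo hi -> sign_at_left p lo sa -> sign_at_right p hi sb ->
  sa * sb < 0 -> between lo hi x0 ->
  exists c, [/\ between lo hi c, p.[c] = 0,
    forall x, between lo (Some c) x -> p.[x] != 0 /\ Num.sg p.[x] = sa &
    forall x, between (Some c) hi x -> p.[x] != 0 /\ Num.sg p.[x] = sb].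
Proof.
move=> mono Ha Hb sab [lox xhi].
have [a [ax sa_a Sa]] := sign_at_left_near Ha lox.
have [b [xb sb_b Sb]] := sign_at_right_near Hb xhi.
have [|c] := @poly_ivtoo _ p a b (ltW (lt_trans ax xb)).
  by rewrite -sgr_lt0 sgrM sa_a sb_b.
rewrite in_itv /= => /andP[ac cb] /eqP pc0.
have sc0 : Num.sg p.[c] = 0 by rewrite pc0 sgr0.
have sa0 : (sa == 0) = false by apply: contraTF sab => /eqP ->; rewrite mul0r ltxx.
exists c; split => //; first by split; [apply: Sa | apply: Sb].
- move=> x Hx.
  have := @sign_between p lo (Some c) sa 0 x; rewrite sa0; apply=> //.
    apply: monotone_on_sub mono => y [? yc]; split => //.
    by apply: Sb; apply: lt_trans yc cb.
  by rewrite mulr0 ltxx.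
- move=> x Hx.
  have := @sign_between p (Some c) hi 0 sb x; rewrite eqxx; apply=> //.
    apply: monotone_on_sub mono => y [cy ?]; split => //.
    by apply: Sa; apply: lt_trans ac cy.
  by rewrite mul0r ltxx.
Qed.

End SignBetween.

(** * Multivariate polynomials as lists of monomials *)

(* A multivariate polynomial is an unordered list of monomials, possibly with
   repetitions; exponent vectors are padded with zeros.  A polynomial in the
   first variable is the list of its coefficients, the leading one first. *)
Notation mpoly R := (seq (R * seq nat)%type).
Notation upoly R := (seq (mpoly R)).

Section Polynomials.
Variable R : realType.
Notation mpoly := (mpoly R).
Notation upoly := (upoly R).

Implicit Types (a : seq R) (p q : mpoly) (u w : upoly).

Fixpoint monomial_at (e : seq nat) a : R :=
  if a is x :: a' then x ^+ head 0%N e * monomial_at (behead e) a' else 1.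

Definition mpoly_at a p : R := \sum_(m <- p) m.1 * monomial_at m.2 a.

Fixpoint add_exponents (e f : seq nat) : seq nat :=
  if e is i :: e' then (i + head 0 f)%N :: add_exponents e' (behead f) else f.

Definition mpoly_scale (c : R) p : mpoly := [seq (c * m.1, m.2) | m <- p].

Definition mpoly_mul p q : mpoly :=
  foldr (fun m s =>
    map (fun m' => (m.1 * m'.1, add_exponents m.2 m'.2)) q ++ s) [::] p.

Lemma monomial_at_nil a : monomial_at [::] a = 1.
Proof. by elim: a => //= y a ->; rewrite mulr1. Qed.

Lemma monomial_at_add e f a :
  monomial_at (add_exponents e f) a = monomial_at e a * monomial_at f a.
Proof.
elim: a e f => [|x a IH] e f /=; first by rewrite mulr1.
case: e => [|i e] /=; first by rewrite monomial_at_nil !mul1r.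
by rewrite exprD IH mulrACA.
Qed.

Lemma mpoly_at_nil a : mpoly_at a [::] = 0.
Proof. exact: big_nil. Qed.

Lemma mpoly_at_cat a p q : mpoly_at a (p ++ q) = mpoly_at a p + mpoly_at a q.
Proof. exact: big_cat. Qed.

Lemma mpoly_at_scale a c p : mpoly_at a (mpoly_scale c p) = c * mpoly_at a p.
Proof.
by rewrite /mpoly_at big_map mulr_sumr; apply: eq_bigr => m _; rewrite mulrA.
Qed.

Lemma mpoly_at_mul a p q :
  mpoly_at a (mpoly_mul p q) = mpoly_at a p * mpoly_at a q.
Proof.
elim: p => [|m p IH] /=; first by rewrite mpoly_at_nil mul0r.
rewrite mpoly_at_cat IH /mpoly_at big_cons mulrDl.
congr (_ + _); rewrite big_map mulr_sumr.
by apply: eq_bigr => m' _; rewrite monomial_at_add mulrACA.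
Qed.

Definition mpoly_coef (k : nat) p : mpoly :=
  [seq (m.1, behead m.2) | m <- [seq m <- p | head 0%N m.2 == k]].

Fixpoint mpoly_coefs (k : nat) p : upoly :=
  mpoly_coef k p :: (if k is k'.+1 then mpoly_coefs k' p else [::]).

Definition degree_bound1 p : nat := foldr (fun m d => (head 0 m.2 + d)%N) 0%N p.

Definition univariate p : upoly := mpoly_coefs (degree_bound1 p) p.

Fixpoint upoly_at a u : {poly R} :=
  if u is c :: u' then (mpoly_at a c)%:P * 'X^(size u') + upoly_at a u' else 0.

Lemma size_mpoly_coefs k p : size (mpoly_coefs k p) = k.+1.
Proof. by elim: k => //= k ->. Qed.

Lemma mpoly_coefs_at k x a p : (upoly_at a (mpoly_coefs k p)).[x] =
  \sum_(m <- p | (head 0%N m.2 <= k)%N) m.1 * monomial_at m.2 (x :: a).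
Proof.
have coefE i : mpoly_at a (mpoly_coef i p) * x ^+ i =
    \sum_(m <- p | head 0%N m.2 == i) m.1 * monomial_at m.2 (x :: a).
  rewrite /mpoly_at big_map big_filter mulr_suml.  apply: eq_bigr => m /eqP <- /=.
  by rewrite mulrAC mulrA.
elim: k => [|k IH] /=; rewrite hornerD hornerCM hornerXn.
  by rewrite horner0 addr0 coefE; apply: eq_bigl => m; rewrite leqn0.
rewrite IH size_mpoly_coefs coefE [RHS](bigID (fun m => head 0%N m.2 == k.+1)).
congr (_ + _) => /=; apply: eq_bigl => m; last by rewrite andbC -ltn_neqAle.
by case: eqP => [->|]; rewrite ?leqnn ?andbF.
Qed.

Lemma univariate_at x a p : (upoly_at a (univariate p)).[x] = mpoly_at (x :: a) p.
Proof.
rewrite mpoly_coefs_at big_seq_cond [RHS]big_seq; apply: eq_bigl => m.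
case: (boolP (m \in p)) => //=; rewrite /degree_bound1.
elim: p => //= m' p IH; rewrite in_cons => /predU1P[->|/IH]; first exact: leq_addr.
by move=> /leq_trans -> //; rewrite leq_addl.
Qed.

End Polynomials.

(** * Derivative and pseudo-remainder in the distinguished variable *)

Section Univariate.
Variable R : realType.
Notation mpoly := (mpoly R).
Notation upoly := (upoly R).
Implicit Types (a : seq R) (p q : mpoly) (u w : upoly).

Fixpoint upoly_deriv u : upoly :=
  if u is c :: u' then
    if nilp u' then [::] else mpoly_scale (size u')%:R c :: upoly_deriv u'
  else [::].

Lemma size_upoly_deriv u : size (upoly_deriv u) = (size u).-1.
Proof. by elim: u => //= c [|c' u] //= ->. Qed.

Lemma upoly_at_deriv a u : upoly_at a (upoly_deriv u) = (upoly_at a u)^`().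
Proof.
elim: u => [|c u IH]; first by rewrite deriv0.
rewrite [upoly_at a (c :: u)]/= derivD derivM derivC mul0r add0r derivXn -IH.
rewrite [upoly_deriv (c :: u)]/=; case: nilP => [->|_] /=.
  by rewrite mulr0n mulr0 addr0.
rewrite size_upoly_deriv mpoly_at_scale polyCM polyC_natr.
by rewrite -[in RHS]mulr_natl mulrCA mulrA.
Qed.

(** Leading coefficients come first, so reading [u] and [w] in parallel aligns them at the top: [w]
    is implicitly multiplied by a power of the variable, and counts as zero once exhausted. *)
Fixpoint cross_combine (b c : mpoly) u w : upoly :=
  if u is d :: u' then
    (mpoly_mul b (mpoly_mul b d) ++
       mpoly_scale (-1) (mpoly_mul b (mpoly_mul c (head [::] w))))
      :: cross_combine b c u' (behead w)
  else [::].

(* Cancels the leading coefficient c of u = c :: u' against that of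
   w = b :: w'.  The factor b ^+ 2 (rather than b) preserves the sign of u at
   the roots of w. *)
Definition reduce1 w u : upoly :=
  if u is c :: u' then
    if w is b :: w' then cross_combine b c u' w' else [::]
  else [::].

(** Each reduction shortens [u] by exactly one, whether or not the cancelled coefficient is zero, so
    the number of steps depends on the sizes alone. *)
Definition pseudo_rem u w : upoly := iter (size u - (size w).-1) (reduce1 w) u.

Lemma size_cross_combine b c u w : size (cross_combine b c u w) = size u.
Proof. by elim: u w => //= d u IH w; rewrite IH. Qed.

Lemma cross_combine_at a x b c u w : (size w <= size u)%N ->
  (upoly_at a (cross_combine b c u w)).[x] =
  mpoly_at a b ^+ 2 * (upoly_at a u).[x]
  - mpoly_at a b * mpoly_at a c * x ^+ (size u - size w) * (upoly_at a w).[x].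
Proof.
have at0 v : (upoly_at a (cross_combine b c v [::])).[x] =
    mpoly_at a b ^+ 2 * (upoly_at a v).[x].
  elim: v => [|d v IH] /=; first by rewrite horner0 mulr0.
  rewrite !hornerD !hornerCM !hornerXn IH size_cross_combine mpoly_at_cat.
  by rewrite mpoly_at_scale !mpoly_at_mul mpoly_at_nil; ring.
elim: u w => [|d u IH] [|e w] //= Hw.
- by rewrite horner0 !mulr0 subr0.
- by rewrite -[RHS]/(_ - _) horner0 mulr0 subr0 -(at0 (d :: u)).
rewrite !hornerD !hornerCM !hornerXn IH // size_cross_combine mpoly_at_cat.
rewrite mpoly_at_scale !mpoly_at_mul subSS.
have -> : x ^+ size u = x ^+ (size u - size w) * x ^+ size w.
  by rewrite -exprD subnK.
by ring.
Qed.

Lemma size_reduce1 w u : (0 < size w)%N -> size (reduce1 w u) = (size u).-1.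
Proof. by case: u w => [|c u] [|b w] //= _; rewrite size_cross_combine. Qed.

Lemma reduce1_at a x u b w : (size w < size u)%N ->
  (upoly_at a (b :: w)).[x] = 0 ->
  (upoly_at a (reduce1 (b :: w) u)).[x] = mpoly_at a b ^+ 2 * (upoly_at a u).[x].
Proof.
case: u => [|c u] //= Hw; rewrite !hornerD !hornerCM !hornerXn => /eqP.
rewrite addr_eq0 => /eqP W0; rewrite cross_combine_at //.
have -> : x ^+ size u = x ^+ (size u - size w) * x ^+ size w.
  by rewrite -exprD subnK.
rewrite -[(upoly_at a w).[x]]opprK -W0; ring.
Qed.

Lemma size_pseudo_rem u w : (0 < size w <= size u)%N ->
  size (pseudo_rem u w) = (size w).-1.
Proof.
move=> /andP[w0 wu]; rewrite /pseudo_rem.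
have iterE k : size (iter k (reduce1 w) u) = (size u - k)%N.
  by elim: k => [|k IH] /=; rewrite ?subn0 // size_reduce1 // IH subnS.
by rewrite iterE subKn // (leq_trans (leq_pred _)).
Qed.

Lemma sg_pseudo_rem a x u w : (0 < size w)%N -> mpoly_at a (head [::] w) != 0 ->
  (upoly_at a w).[x] = 0 ->
  Num.sg (upoly_at a (pseudo_rem u w)).[x] = Num.sg (upoly_at a u).[x].
Proof.
case: w => // b w _ /= b0 W0; rewrite /pseudo_rem /=.
move Hk: (size u - size w)%N => k; elim: k u Hk => [//|k IH] u Hk.
rewrite iterSr IH; last by rewrite size_reduce1 // -subn1 subnAC Hk subn1.
rewrite reduce1_at //; last by rewrite -subn_gt0 Hk.
by rewrite sgrM gtr0_sg ?mul1r // exprn_even_gt0.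
Qed.

End Univariate.

(** The default 0 matters: it is the correct sign of the empty coefficient list, the zero
    polynomial, which no table contains. *)
Fixpoint lookup (R : realType) (T : eqType) (x : T) (l : seq T) (v : seq R) : R :=
  if l is y :: l' then if x == y then head 0 v else lookup x l' (behead v) else 0.

Lemma lookup_map (R : realType) (T : eqType) (f : T -> R) x l :
  x \in l -> lookup x l (map f l) = f x.
Proof.
elim: l => //= y l IH; rewrite in_cons; case: eqP => [->|_] //=.
Qed.

Lemma lookup_notin (R : realType) (T : eqType) x (l : seq T) (v : seq R) :
  x \notin l -> lookup x l v = 0.
Proof.
elim: l v => //= y l IH v; rewrite in_cons negb_or => /andP[/negPf -> /IH]; exact.
Qed.

(** * Sign tables *)

Section SignTable.
Variable R : realType.
Notation mpoly := (mpoly R).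
Notation upoly := (upoly R).
Notation row := (seq R).
Variable sigma : mpoly -> R.
Implicit Types (u w : upoly) (P C : seq upoly) (r : row) (x y : R).

(* [sigma] gives the signs of the coefficients at a fixed point of R^(N-1);
   [strip] removes the leading coefficients that vanish there. *)
Fixpoint strip u : upoly :=
  if u is c :: u' then if sigma c == 0 then strip u' else u else [::].

Fixpoint vanishing P r : upoly :=
  if P is q :: P' then if head 1 r == 0 then q else vanishing P' (behead r)
  else [::].

Definition sign_row P r u : R := lookup (strip u) P r.

(** The remainder is shorter than the polynomial that vanishes at the point, hence its sign there is
    already in the table. *)
Definition sign_root P u r : R := sign_row P r (pseudo_rem u (vanishing P r)).

(* A table (r0, [:: (s1, r1); ...; (sm, rm)]) lists the sign vectors on the
   consecutive intervals (ri) and separating points (si) of the line. *)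
Notation table := (row * seq (row * row))%type.

(** Without a sign change, one end may itself be a root of the new polynomial, and then the other
    end gives the sign. Both ends cannot be roots of a polynomial that is strictly monotone or a
    nonzero constant in between. *)
Definition cut (sa sb : R) (r0 : row) (rest : seq (row * row)) : table :=
  if sa * sb < 0 then (sa :: r0, (0 :: r0, sb :: r0) :: rest)
  else ((if sa == 0 then sb else sa) :: r0, rest).

(** [t] pairs the sign of the new polynomial at the left end of the current interval with the old
    row of that interval; [sinf] is its sign at plus infinity. *)
Fixpoint insert (st : row -> R) (sinf : R) (rest : seq (row * row))
    (t : R * row) : table :=
  if rest is sr :: rest' then
    let sb := st sr.1 in
    let T := insert st sinf rest' (sb, sr.2) in
    cut t.1 sb t.2 ((sb :: sr.1, T.1) :: T.2)
  else cut t.1 sinf t.2 [::].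

Definition extend_table u (st : seq upoly * table) : seq upoly * table :=
  (u :: st.1,
   insert (sign_root st.1 u) (sigma (head [::] u)) st.2.2
     (sigma (head [::] u) * (-1) ^+ (size u).-1, st.2.1)).

(** The largest come first, because [foldr] in [sign_table] processes the list from its end. *)
Fixpoint by_size C n : seq upoly :=
  if n is n'.+1 then
    [seq u <- C | (size u == n) && (sigma (head [::] u) != 0)] ++ by_size C n'
  else [::].

Definition sign_table C n : seq upoly * table :=
  foldr extend_table ([::], ([::], [::])) (by_size C n).

Definition rows (T : table) : seq row :=
  T.1 :: foldr (fun sr s => sr.1 :: sr.2 :: s) [::] T.2.

Lemma mem_by_size C n u : (u \in by_size C n) =
  [&& u \in C, (0 < size u <= n)%N & sigma (head [::] u) != 0].
Proof.
elim: n => [|n IH] /=; first by case: u => //= *; rewrite andbF.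
rewrite mem_cat mem_filter IH; case: (u \in C); last by rewrite andbF.
rewrite !andbT; case: (_ != 0); rewrite ?andbF ?andbT //=.
by rewrite (leq_eqVlt _ n.+1) ltnS; case: eqP => [->|].
Qed.

Variable a : seq R.
Notation sg_at u x := (Num.sg (upoly_at a u).[x]).
Notation signs P x := [seq sg_at u x | u <- P].

Lemma vanishingP P x : 0 \in signs P x ->
  vanishing P (signs P x) \in P /\ (upoly_at a (vanishing P (signs P x))).[x] = 0.
Proof.
elim: P => //= q P IH; rewrite in_cons sgr_eq0 eq_sym sgr_eq0.
case: eqP => [q0 _|_ /= /IH [H1 H2]]; first by rewrite mem_head.
by rewrite in_cons H1 orbT.
Qed.

(** The conditions on zeros say that the separating points to the right of [lo] are exactly the
    roots there of the members of [P]. Hence some member vanishes at each of them, and no member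
    changes sign in between. *)
Fixpoint describes P (lo : option R) (r0 : row) (rest : seq (row * row)) : Prop :=
  0 \notin r0 /\
  if rest is sr :: rest' then
    exists y, [/\ above lo y, forall x, between lo (Some y) x -> signs P x = r0,
      signs P y = sr.1, 0 \in sr.1 & describes P (Some y) sr.2 rest']
  else forall x, between lo None x -> signs P x = r0.

Lemma between_inhabited (lo hi : option R) :
  (if hi is Some b then above lo b else true) -> exists x, between lo hi x.
Proof.
case: lo hi => [l|] [h|] /= H.
- by exists ((l + h) / 2); split => /=; lra.
- by exists (l + 1); split => //=; lra.
- by exists (h - 1); split => //=; lra.
- by exists 0.
Qed.

Lemma describes_rows P lo r0 rest r : describes P lo r0 rest ->
  r \in rows (r0, rest) <-> exists2 x, above lo x & signs P x = r.
Proof.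
elim: rest lo r0 => [|[s1 r1] rest IH] lo r0 /= [_].
  move=> H; rewrite /rows inE; split=> [/eqP ->|[x lox <-]].
    by have [//|x Hx] := @between_inhabited lo None; exists x; [case: Hx | apply: H].
  by rewrite H.
move=> [y [loy H0 H1 _ H2]].
rewrite -[rows _]/(r0 :: s1 :: rows (r1, rest)) 2!inE; split.
  case/or3P => [/eqP ->|/eqP ->|/(IH _ _ H2)[x yx <-]].
  - by have [//|x Hx] := @between_inhabited lo (Some y); exists x; [case: Hx | apply: H0].
  - by exists y.
  - exists x => //; case: (lo) loy => //= l ly; exact: lt_trans ly yx.
move=> [x lox rE]; case: (ltgtP x y) rE => [xy|yx|->] rE.
- by rewrite -rE H0 ?eqxx.
- by apply/or3P/Or33; apply/(IH _ _ H2); exists x.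
- by rewrite -rE H1 eqxx orbT.
Qed.

(** The part of a table from [hi] on. It lets [cut_describes] treat an inner interval and the last,
    unbounded one alike. *)
Definition describes_from P (hi : option R) (rest : seq (row * row)) : Prop :=
  if hi is Some y then
    if rest is sr :: rest' then
      [/\ signs P y = sr.1, 0 \in sr.1 & describes P (Some y) sr.2 rest']
    else False
  else rest = [::].

Lemma describesI P lo hi r0 rest :
  0 \notin r0 -> (if hi is Some b then above lo b else true) ->
  (forall x, between lo hi x -> signs P x = r0) ->
  describes_from P hi rest -> describes P lo r0 rest.
Proof.
case: hi => [y|] r00 loy const; last by move=> /= ->.
by case: rest => //= sr rest [? ? ?]; split=> //; exists y; split.
Qed.

Lemma cut_describes P u lo hi sa sb r0 rest :
  0 \notin r0 -> (if hi is Some b then above lo b else true) ->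
  (forall x, between lo hi x -> signs P x = r0) ->
  monotone_on (upoly_at a u) lo hi ->
  sign_at_left (upoly_at a u) lo sa -> sign_at_right (upoly_at a u) hi sb ->
  describes_from (u :: P) hi rest ->
  describes (u :: P) lo (cut sa sb r0 rest).1 (cut sa sb r0 rest).2.
Proof.
move=> r00 lohi const mono Ha Hb Hrest.
have [x0 Hx0] := between_inhabited lohi.
rewrite /cut; case: ifPn => sab; rewrite [fst _]/= [snd _]/=.
  have [c [[loc chi] pc0 Hl Hr]] := sign_between_split mono Ha Hb sab Hx0.
  have sa0 : sa != 0 by apply: contraTneq sab => ->; rewrite mul0r ltxx.
  have sb0 : sb != 0 by apply: contraTneq sab => ->; rewrite mulr0 ltxx.
  apply: (@describesI _ lo (Some c)) => //=.
  - by rewrite in_cons negb_or eq_sym sa0.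
  - move=> x Hx; rewrite (Hl x Hx).2 const //; case: Hx => ? xc; split => //.
    by case: (hi) chi => //= h; apply: lt_trans.
  split; rewrite ?mem_head //; first by rewrite /= pc0 sgr0 const.
  apply: (@describesI _ (Some c) hi) => //=.
  - by rewrite in_cons negb_or eq_sym sb0.
  move=> x Hx; rewrite (Hr x Hx).2 const //; case: Hx => cx ?; split => //.
  by case: (lo) loc => //= l lc; apply: lt_trans lc cx.
have [p0 sx] := sign_between mono Ha Hb sab Hx0.
apply: (@describesI _ lo hi) => //.
- by rewrite in_cons negb_or r00 andbT -sx eq_sym sgr_eq0.
- move=> x Hx; rewrite /= const //; congr (_ :: _).
  by have [_ ->] := sign_between mono Ha Hb sab Hx.
Qed.

Lemma insert_describes P u (st : row -> R) sinf lo sa r0 rest :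
  (forall lo hi r, (forall x, between lo hi x -> signs P x = r) -> 0 \notin r ->
     monotone_on (upoly_at a u) lo hi) ->
  (forall y, 0 \in signs P y -> st (signs P y) = sg_at u y) ->
  sign_at_right (upoly_at a u) None sinf ->
  sign_at_left (upoly_at a u) lo sa ->
  describes P lo r0 rest ->
  describes (u :: P) lo (insert st sinf rest (sa, r0)).1
    (insert st sinf rest (sa, r0)).2.
Proof.
move=> mono Hst Hinf; elim: rest lo sa r0 => [|[s1 r1] rest IH] lo sa r0 Ha /= [r00].
  by move=> const; apply: (@cut_describes _ _ lo None) => //; apply: mono r00.
move=> [y [loy const Hy s10 Hrest]].
have sy : st s1 = sg_at u y by rewrite -Hy Hst // Hy.
apply: (@cut_describes _ _ lo (Some y)) => //; first exact: mono const r00.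
split; [by rewrite /= Hy sy | by rewrite in_cons s10 orbT | exact: IH].
Qed.

Variable C : seq upoly.
Hypothesis sound : forall u c, u \in C -> c \in u -> sigma c = Num.sg (mpoly_at a c).
Hypothesis C_behead : forall u, u \in C -> behead u \in C.
Hypothesis C_deriv : forall u, u \in C -> upoly_deriv u \in C.
Hypothesis C_rem : forall u w, u \in C -> w \in C -> (0 < size w <= size u)%N ->
  pseudo_rem u w \in C.

Lemma sound_eq0 u c : u \in C -> c \in u -> (sigma c == 0) = (mpoly_at a c == 0).
Proof. by move=> uC cu; rewrite (sound uC cu) sgr_eq0. Qed.

Lemma stripP u : u \in C ->
  [/\ strip u \in C, (size (strip u) <= size u)%N,
     upoly_at a (strip u) = upoly_at a u &
     strip u <> [::] -> sigma (head [::] (strip u)) != 0].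
Proof.
elim: u => [|c u IH] //= uC; case: ifPn => [c0|c0]; last by split.
have [H1 H2 H3 H4] := IH (C_behead uC); split => //; first exact: leqW.
move: c0; rewrite (sound_eq0 uC) ?mem_head // => /eqP ->.
by rewrite mul0r add0r.
Qed.

Lemma size_upoly_at u : u \in C -> (0 < size u)%N -> sigma (head [::] u) != 0 ->
  size (upoly_at a u) = size u /\
  lead_coef (upoly_at a u) = mpoly_at a (head [::] u).
Proof.
case: u => //= c u uC _; rewrite (sound_eq0 uC) ?mem_head // => c0.
have su v : (size (upoly_at a v) <= size v)%N.
  elim: v => [|d v IH] /=; first by rewrite size_poly0.
  apply: leq_trans (size_polyD _ _) _; rewrite geq_max (leqW IH) andbT.
  rewrite mul_polyC; apply: leq_trans (size_scale_leq _ _) _.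
  by rewrite size_polyXn.
have sc : size ((mpoly_at a c)%:P * 'X^(size u)) = (size u).+1.
  by rewrite mul_polyC size_scale // size_polyXn.
rewrite size_polyDl ?sc ?ltnS // lead_coefDl ?sc ?ltnS //; split => //.
by rewrite lead_coefM lead_coefC lead_coefXn mulr1.
Qed.

Section RowSigns.
Variables (n : nat) (P : seq upoly).
Hypothesis P_small : {subset by_size C n <= P}.
Hypothesis P_nil : [::] \notin P.

(** After stripping, [u] is either empty, so zero on the whole line and absent from [P], or it has a
    nonzero leading coefficient and belongs to [by_size C n]. *)
Lemma sign_rowP u x : u \in C -> (size u <= n)%N ->
  sign_row P (signs P x) u = sg_at u x.
Proof.
move=> uC un; have [sC sn <- sg] := stripP uC; rewrite /sign_row.
have [E|s0] := eqVneq (strip u) [::].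
  by rewrite E lookup_notin //= horner0 sgr0.
rewrite (@lookup_map _ _ (fun u => sg_at u x)) // P_small //.
by rewrite mem_by_size sC lt0n size_eq0 s0 (leq_trans sn un) sg //; apply/eqP.
Qed.

End RowSigns.

(** [P] may already hold other polynomials as long as [u], so it is only pinned between two levels:
    the lower inclusion makes the derivative and the remainders of [u] available, the upper one
    bounds the divisors. *)
Lemma extend_table_describes n P u T : u \in C -> size u = n.+1 ->
  sigma (head [::] u) != 0 ->
  {subset by_size C n <= P} -> {subset P <= by_size C n.+1} ->
  describes P None T.1 T.2 ->
  describes (u :: P) None (extend_table u (P, T)).2.1 (extend_table u (P, T)).2.2.
Proof.
move=> uC su lu subP Psub; case: T => [r0 rest] /= HT.
have Pnil : [::] \notin P by apply/negP => /Psub; rewrite mem_by_size andbF.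
have u0 : (0 < size u)%N by rewrite su.
have [sp lp] := size_upoly_at uC u0 lu.
have hu : head [::] u \in u by case: (u) u0 => // *; rewrite mem_head.
have p0 : upoly_at a u != 0 by rewrite -size_poly_eq0 sp su.
have slu := sound uC hu.
apply: insert_describes HT.
(* For size 1 the polynomial is a nonzero constant. Otherwise its derivative is in the table, and a
   row without zeros shows that it has no root on the interval. *)
- move=> lo hi r const r0'; case: n su subP {Psub} => [|m] su subP.
    left; exists (mpoly_at a (head [::] u)); first by rewrite -lp lead_coef_eq0.
    by case: (u) su => [|c []] //= _; rewrite addr0 mulr1.
  right => x /const rE; rewrite -upoly_at_deriv -sgr_eq0; apply: contraNneq r0' => d0.
  rewrite -rE -d0; apply: map_f; apply: subP.
  have dC := C_deriv uC; have sd := size_upoly_deriv u.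
  rewrite mem_by_size dC sd su /= ltnSn /=.
  have cd : head [::] (upoly_deriv u) \in upoly_deriv u.
    by case: (upoly_deriv u) sd; rewrite su // => *; rewrite mem_head.
  (* The leading coefficient of the derivative is a positive integer multiple of that of [u], so it
     does not vanish either. *)
  rewrite (sound_eq0 dC cd); case: (u) su lu hu uC => [|c [|c' v]] //= _.
  move=> lu hu uC; rewrite mpoly_at_scale mulf_eq0 pnatr_eq0 /=.
  by rewrite -(sound_eq0 uC hu).
(* The divisor [q] may be as long as [u], but the remainder is shorter than [q] and so has size at
   most [n]. *)
- move=> y y0; have [qP qy] := vanishingP y0; rewrite /sign_root.
  move: (vanishing _ _) qP qy => q qP qy.
  have := Psub _ qP; rewrite mem_by_size => /and3P[qC /andP[q0 qn] lq].
  have hq : head [::] q \in q by case: (q) q0 => // *; rewrite mem_head.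
  have qu : (0 < size q <= size u)%N by rewrite q0 su.
  have sr := size_pseudo_rem qu.
  rewrite (sign_rowP subP Pnil) ?C_rem ?sr //; last first.
    by rewrite -ltnS; apply: leq_trans qn; rewrite prednK.
  by rewrite sg_pseudo_rem // -(sound_eq0 qC hq).
- by rewrite slu -lp; apply: sign_at_pinfty.
- by rewrite slu -lp -sp; apply: sign_at_minfty.
Qed.

Lemma sign_tableP n : (sign_table C n).1 = by_size C n /\
  describes (by_size C n) None (sign_table C n).2.1 (sign_table C n).2.2.
Proof.
rewrite /sign_table; elim: n => [|n [IH1 IH2]] //=.
rewrite foldr_cat; move: IH1 IH2; case: (foldr _ _ (by_size C n)) => P0 T0 /= -> HT.
set s0 := [seq u <- C | _].
(* Polynomials of equal size enter one at a time, hence an inner induction over those of size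
   [n.+1]. *)
suff H s : {subset s <= s0} ->
    let st := foldr extend_table (by_size C n, T0) s in
    st.1 = s ++ by_size C n /\ describes (s ++ by_size C n) None st.2.1 st.2.2.
  exact: H.
elim: s => [|u s IH] // sub.
have sub' : {subset s <= s0} by move=> w ws; apply: sub; rewrite in_cons ws orbT.
have := IH sub'; cbv zeta.
rewrite [foldr _ _ (u :: s)]/=; case: (foldr _ _ s) => P T [/= -> HT'].
have := sub _ (mem_head u s); rewrite mem_filter => /andP[/andP[/eqP su lu] uC].
split=> //; apply: (@extend_table_describes n (s ++ by_size C n) u T) => //.
- by move=> w wn; rewrite mem_cat wn orbT.
- by move=> w; rewrite /= !mem_cat => /orP[/sub' ->|->] //; rewrite orbT.
Qed.

Lemma sign_table_rows n us : {subset us <= C} ->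
  (forall u, u \in us -> (size u <= n)%N) ->
  forall v, v \in [seq [seq sign_row (sign_table C n).1 r u | u <- us]
                  | r <- rows (sign_table C n).2] <->
    exists x, v = signs us x.
Proof.
move=> sub small v; have [-> HT] := sign_tableP n.
have nil : [::] \notin by_size C n by rewrite mem_by_size andbF.
have eqv x : [seq sign_row (by_size C n) (signs (by_size C n) x) u | u <- us] =
    signs us x.
  by apply/eq_in_map => u uus; apply: sign_rowP (small _ uus); rewrite // sub.
move: HT; case: (sign_table C n).2 => r0 rest HT; split.
  case/mapP => r /(describes_rows _ HT)[x _ <-] ->; exists x; exact: eqv.
case=> x ->; apply/mapP; exists (signs (by_size C n) x) => //.
by apply/(describes_rows _ HT); exists x.
Qed.

End SignTable.

(** * Elimination of a variable *)

Section SignVectors.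
Variable R : realType.
Notation mpoly := (mpoly R).
Notation upoly := (upoly R).
Notation row := (seq R).
Implicit Types (u w : upoly) (C us : seq upoly) (L : seq mpoly) (v : row).

Definition remainders C u : seq upoly :=
  [seq pseudo_rem u w | w <- [seq w <- C | (0 < size w <= size u)%N]].

Definition derived_step C : seq upoly :=
  C ++ map behead C ++ map (@upoly_deriv R) C ++ flatten [seq remainders C u | u <- C].

Definition derived_closure n C : seq upoly := iter n derived_step C.

Definition total_size us : nat := foldr (fun u d => (size u + d)%N) 0%N us.

Lemma derived_step_sub C : {subset C <= derived_step C}.
Proof. by move=> u uC; rewrite mem_cat uC. Qed.

Lemma derived_step_behead C u : u \in C -> behead u \in derived_step C.
Proof. by move=> uC; rewrite !mem_cat map_f ?orbT. Qed.

Lemma derived_step_deriv C u : u \in C -> upoly_deriv u \in derived_step C.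
Proof. by move=> uC; rewrite !mem_cat (map_f (@upoly_deriv R) uC) ?orbT. Qed.

Lemma derived_step_rem C u w : u \in C -> w \in C -> (0 < size w <= size u)%N ->
  pseudo_rem u w \in derived_step C.
Proof.
move=> uC wC wu; rewrite !mem_cat; apply/orP; right; apply/orP; right.
apply/orP; right; apply/flatten_mapP; exists u => //.
by apply: map_f; rewrite mem_filter wu.
Qed.

(* Every new element is smaller than some argument that was itself new in the
   previous round. *)
Lemma derived_closure_new n j C u : (forall u, u \in C -> (size u <= n)%N) ->
  u \in derived_closure j.+1 C -> u \notin derived_closure j C -> (size u + j < n)%N.
Proof.
move=> small.
have new0 w : w \in C -> ((0 < size w) -> size w <= n)%N by move=> /small.
elim: j u => [|j IH] u.
  rewrite addn0 /derived_closure /= !mem_cat => H uC; rewrite (negPf uC) /= in H.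
  case/or3P: H => [/mapP[w wC uE]|/mapP[w wC uE]|/flatten_mapP[w wC]].
  - have := small _ wC; rewrite uE in uC *; case: w wC uC {uE} => [|c w] //= ->.
    by [].
  - have := small _ wC; rewrite uE in uC *; rewrite size_upoly_deriv.
    by case: w wC uC {uE} => [|c w] //= ->.
  - case/mapP=> z; rewrite mem_filter => /andP[/andP[z0 zw] zC] ->.
    rewrite size_pseudo_rem ?z0 //; have := small _ zC; by case: (z) z0.
have clS : derived_closure j.+2 C = derived_step (derived_closure j.+1 C) by [].
move=> H uC; move: H; rewrite clS {1}/derived_step mem_cat (negPf uC) /= !mem_cat => H.
have {}clS : derived_closure j.+1 C = derived_step (derived_closure j C) by [].
have new w : w \in derived_closure j.+1 C -> (size w + j < n)%N \/ w \in derived_closure j C.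
  by move=> wC; case: (boolP (w \in derived_closure j C)) => [|/(IH _ wC)]; [right|left].
case/or3P: H => [/mapP[w wC uE]|/mapP[w wC uE]|/flatten_mapP[w wC]].
- case: (new _ wC) => [|wC']; last by rewrite uE clS derived_step_behead in uC.
  move: uC; rewrite uE; case: (w) wC => [->|c z] //= _ _.
  by rewrite addnS addSn.
- case: (new _ wC) => [|wC']; last by rewrite uE clS derived_step_deriv in uC.
  move: uC; rewrite uE size_upoly_deriv; case: (w) wC => [->|c z] //= _ _.
  by rewrite addnS addSn.
- case/mapP=> z; rewrite mem_filter => /andP[zw zC] uE; have /andP[z0 zlew] := zw.
  (* A new remainder requires a new divisor or a new dividend. The divisor is the shorter of the
     two, so the bound reaches it in both cases. *)
  have : (size z + j < n)%N.
    case: (new _ zC) => // zC'; case: (new _ wC) => [|wC'].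
      by apply: leq_ltn_trans; rewrite leq_add2r.
    by rewrite uE clS derived_step_rem in uC.
  by rewrite uE size_pseudo_rem //; case: (size z) z0 => //= k _; rewrite addnS addSn.
Qed.

(** An element first appearing in round n + 1 would satisfy [size u + n < n]. *)
Lemma derived_closure_closed n C : (forall u, u \in C -> (size u <= n)%N) ->
  {subset derived_step (derived_closure n C) <= derived_closure n C}.
Proof.
move=> small u uC; apply/negPn/negP => nuC.
by have := derived_closure_new small uC nuC; rewrite ltnNge leq_addl.
Qed.

Lemma derived_closure_sub n C : {subset C <= derived_closure n C}.
Proof. by elim: n => //= n IH u /IH; apply: derived_step_sub. Qed.

Lemma total_sizeP us u : u \in us -> (size u <= total_size us)%N.
Proof.
elim: us => //= w us IH; rewrite in_cons => /predU1P[->|/IH]; first exact: leq_addr.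
by move=> /leq_trans -> //; rewrite leq_addl.
Qed.

Definition univariates L : seq upoly := map (@univariate R) L.

Definition elimination_set L : seq upoly :=
  derived_closure (total_size (univariates L)) (univariates L).

Definition project L : seq mpoly := flatten (elimination_set L).

(** The base point enters only through [v]. Points with the same signs on [project L] share a table,
    which leaves finitely many fibres to inspect. *)
Definition fiber_vectors L v : seq row :=
  let T := sign_table (fun c => lookup c (project L) v) (elimination_set L)
             (total_size (univariates L)) in
  [seq [seq sign_row (fun c => lookup c (project L) v) T.1 r u
       | u <- univariates L] | r <- rows T.2].

(** At the only point of R^0 every monomial is 1, so the exponents can be ignored. *)
Definition constant_term (p : mpoly) : R := foldr (fun m s => m.1 + s) 0 p.

Fixpoint sign_vectors N L : seq row :=
  if N is N'.+1 then
    flatten [seq fiber_vectors L v | v <- sign_vectors N' (project L)]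
  else [:: [seq Num.sg (constant_term p) | p <- L]].

Lemma fiber_vectorsP L a v :
  v \in fiber_vectors L [seq Num.sg (mpoly_at a p) | p <- project L] <->
  exists x, v = [seq Num.sg (mpoly_at (x :: a) p) | p <- L].
Proof.
have closed := derived_closure_closed (@total_sizeP (univariates L)).
rewrite (@sign_table_rows _ _ a) //.
- by split=> -[x ->]; exists x; rewrite -map_comp; apply: eq_map => p /=;
    rewrite univariate_at.
- move=> u c uC cu; rewrite (@lookup_map _ _ (fun p => Num.sg (mpoly_at a p))) //.
  by apply/flattenP; exists u.
- by move=> u uC; apply/closed/derived_step_behead.
- by move=> u uC; apply/closed/derived_step_deriv.
- by move=> u w uC wC wu; apply/closed/derived_step_rem.
- exact: derived_closure_sub.
- exact: total_sizeP.
Qed.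

Lemma sign_vectorsP N L v : v \in sign_vectors N L <->
  exists2 a, size a = N & v = [seq Num.sg (mpoly_at a p) | p <- L].
Proof.
elim: N L v => [|N IH] L v /=.
  have const p : constant_term p = mpoly_at [::] p.
    rewrite /mpoly_at; elim: p => [|m p IH] /=; first by rewrite big_nil.
    by rewrite big_cons mulr1 IH.
  rewrite inE; split=> [/eqP ->|[a /size0nil -> ->]].
    by exists [::] => //; apply: eq_map => p; rewrite const.
  by apply/eqP; apply: eq_map => p; rewrite const.
split.
  case/flatten_mapP=> w /IH[a sa ->] /fiber_vectorsP[x ->].
  by exists (x :: a); rewrite /= ?sa.
case=> -[|x a] //= [sa] ->; apply/flatten_mapP.
exists [seq Num.sg (mpoly_at a p) | p <- project L]; first by apply/IH; exists a.
by apply/fiber_vectorsP; exists x.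
Qed.

End SignVectors.

(** * Reduction of consistency to sign vectors *)

(** A type of boolean combinations that does not depend on the number of events; it mirrors the
    real-free values of the machine. *)
Inductive tree := TNil | TCons of tree & tree.

Fixpoint tree_list (ts : seq tree) : tree :=
  if ts is t :: ts' then TCons t (tree_list ts') else TNil.

Definition tree_nat (k : nat) : tree := tree_list (nseq k TNil).

Fixpoint tree_of_combination n (B : boolean_combination n) : tree :=
  match B with
  | BVar i => tree_list [:: tree_nat 0; tree_nat i]
  | BNot B1 => tree_list [:: tree_nat 1; tree_of_combination B1]
  | BAnd B1 B2 =>
      tree_list [:: tree_nat 2; tree_of_combination B1; tree_of_combination B2]
  | BOr B1 B2 =>
      tree_list [:: tree_nat 3; tree_of_combination B1; tree_of_combination B2]
  | BTrue => tree_list [:: tree_nat 4]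
  | BFalse => tree_list [:: tree_nat 5]
  end.

(* A tree is at the same time a list of trees; its data are its truth value as
   a boolean combination, and the truth values and lengths of its elements. *)
Notation tree_data := (bool * (seq bool * seq nat))%type.

(** The tags are those of [combination_value]; numbers are unary, so a tag is the length of the
    first list element. [d] holds the data of the list of arguments. Tag 5 ends in the last branch
    as false. *)
Definition tree_connective (w : seq bool) (tag : nat) (d : tree_data) : bool :=
  let b1 := head false d.2.1 in
  let b2 := head false (behead d.2.1) in
  if tag == 0%N then nth false w (head 0%N d.2.2)
  else if tag == 1%N then ~~ b1
  else if tag == 2%N then b1 && b2
  else if tag == 3%N then b1 || b2
  else tag == 4%N.

Definition tree_data_cons (w : seq bool) (d1 d2 : tree_data) : tree_data :=
  (tree_connective w (size d1.2.1) d2,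
   (d1.1 :: d2.2.1, size d1.2.1 :: d2.2.2)).

Fixpoint tree_fold (w : seq bool) (t : tree) : tree_data :=
  if t is TCons t1 t2 then tree_data_cons w (tree_fold w t1) (tree_fold w t2)
  else (false, ([::], [::])).

Definition tree_eval (t : tree) (w : seq bool) : bool := (tree_fold w t).1.

Fixpoint combination_eval n (B : boolean_combination n) (w : seq bool) : bool :=
  match B with
  | BVar i => nth false w i
  | BNot B1 => ~~ combination_eval B1 w
  | BAnd B1 B2 => combination_eval B1 w && combination_eval B2 w
  | BOr B1 B2 => combination_eval B1 w || combination_eval B2 w
  | BTrue => true
  | BFalse => false
  end.

Lemma tree_of_combination_eval n (B : boolean_combination n) w :
  tree_eval (tree_of_combination B) w = combination_eval B w.
Proof.
have len k : size (tree_fold w (tree_nat k)).2.1 = k.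
  by rewrite /tree_nat; elim: k => //= k ->.
elim: B => [i|B1 IH1|B1 IH1 B2 IH2|B1 IH1 B2 IH2||] //=.
- by rewrite /tree_eval /= /tree_connective /= len.
- by rewrite -IH1.
- by rewrite -IH1 -IH2.
- by rewrite -IH1 -IH2.
Qed.

Fixpoint valuations (n : nat) : seq (seq bool) :=
  if n is n'.+1 then
    map (cons true) (valuations n') ++ map (cons false) (valuations n')
  else [:: [::]].

Lemma valuations_uniq n : uniq (valuations n).
Proof.
elim: n => //= n IH; rewrite cat_uniq !map_inj_uniq ?IH //; try by move=> ? ? [].
by rewrite andbT; apply/hasPn => _ /mapP[w _ ->]; apply/mapP => -[].
Qed.

(** * The polynomial system in the probabilities of the atoms *)

Section System.
Variable R : realType.
Notation mpoly := (mpoly R).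
Implicit Types (a : seq R) (ws : seq (seq bool)) (b : seq bool -> bool).

(* The unknowns are the probabilities of the atoms ws; e is the exponent
   vector of the unknown that belongs to the first one. *)
Fixpoint event_poly b ws (e : seq nat) : mpoly :=
  if ws is w :: ws' then
    if b w then (1, e) :: event_poly b ws' (0%N :: e)
    else event_poly b ws' (0%N :: e)
  else [::].

Fixpoint atom_polys ws (e : seq nat) : seq mpoly :=
  if ws is w :: ws' then [:: (1, e)] :: atom_polys ws' (0%N :: e) else [::].

Definition mpoly_exp (p : mpoly) (k : nat) : mpoly :=
  iter k (mpoly_mul p) [:: (1, [::])].

Fixpoint monomial_subst (ps : seq mpoly) (e : seq nat) : mpoly :=
  if ps is p :: ps' then
    mpoly_mul (mpoly_exp p (head 0%N e)) (monomial_subst ps' (behead e))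
  else [:: (1, [::])].

Definition mpoly_subst (ps : seq mpoly) (g : mpoly) : mpoly :=
  foldr (fun m s => mpoly_scale m.1 (monomial_subst ps m.2) ++ s) [::] g.

Notation raw_environment :=
  (nat * (nat * (nat * (seq tree * (seq (nat * mpoly) * unit)))))%type.

Definition atoms_of (E : raw_environment) := valuations E.1.

(** The number in front of a polynomial is the tag of its relation to zero: 0 for equality, 1 for
    inequality, 2 for nonnegativity. *)
Definition system (E : raw_environment) : seq (nat * mpoly) :=
  [seq (2%N, p) | p <- atom_polys (atoms_of E) [:: 1%N]] ++
  (0%N, (-1, [::]) :: event_poly (fun=> true) (atoms_of E) [:: 1%N]) ::
  [seq (g.1, mpoly_subst
          [seq event_poly (tree_eval t) (atoms_of E) [:: 1%N] | t <- E.2.2.2.1] g.2)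
  | g <- E.2.2.2.2.1].

Definition sign_holds (k : nat) (s : R) : bool :=
  if k == 0%N then s == 0 else if k == 1%N then s != 0 else ~~ (s < 0).

Fixpoint signs_hold (ks : seq nat) (v : seq R) : bool :=
  if ks is k :: ks' then sign_holds k (head 0 v) && signs_hold ks' (behead v)
  else true.

Definition decide (E : raw_environment) : bool :=
  has (signs_hold (map fst (system E)))
    (sign_vectors (size (atoms_of E)) (map snd (system E))).

Lemma mpoly_at_one a : mpoly_at a [:: (1, [::])] = 1.
Proof. by rewrite /mpoly_at big_seq1 monomial_at_nil mulr1. Qed.

Lemma mpoly_at_exp a p k : mpoly_at a (mpoly_exp p k) = mpoly_at a p ^+ k.
Proof.
elim: k => [|k IH]; first by rewrite mpoly_at_one.
by rewrite exprS -IH -mpoly_at_mul.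
Qed.

Lemma mpoly_at_subst a ps g :
  mpoly_at a (mpoly_subst ps g) = mpoly_at (map (mpoly_at a) ps) g.
Proof.
have monE e : mpoly_at a (monomial_subst ps e) = monomial_at e (map (mpoly_at a) ps).
  elim: ps e => [|p ps IH] e /=; first exact: mpoly_at_one.
  by rewrite mpoly_at_mul mpoly_at_exp IH.
elim: g => [|m g IH] /=; first by rewrite !mpoly_at_nil.
by rewrite mpoly_at_cat mpoly_at_scale monE IH /mpoly_at big_cons.
Qed.

Lemma monomial_at_unit s x a :
  monomial_at (ncons (size s) 0%N [:: 1%N]) (s ++ x :: a) = x.
Proof.
elim: s => [|y s IH] /=; first by rewrite expr1 monomial_at_nil mulr1.
by rewrite IH mul1r.
Qed.

(** Generalized over the values [s] of the atoms already passed, whose number is the padding of the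
    exponent vector. *)
Lemma event_poly_at b ws (P : seq bool -> R) s :
  mpoly_at (s ++ map P ws) (event_poly b ws (ncons (size s) 0%N [:: 1%N])) =
  \sum_(w <- ws | b w) P w.
Proof.
elim: ws s => [|w ws IH] s /=; first by rewrite big_nil mpoly_at_nil.
have := IH (rcons s (P w)); rewrite size_rcons cat_rcons /= => IHw.
rewrite big_cons; case: ifP => _ //.
by rewrite -IHw /mpoly_at big_cons /= monomial_at_unit mul1r.
Qed.

Lemma atom_polys_at ws (P : seq bool -> R) s :
  map (mpoly_at (s ++ map P ws)) (atom_polys ws (ncons (size s) 0%N [:: 1%N])) =
  map P ws.
Proof.
elim: ws s => [|w ws IH] s //=.
have := IH (rcons s (P w)); rewrite size_rcons cat_rcons /= => ->.
by rewrite /mpoly_at big_seq1 /= monomial_at_unit mul1r.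
Qed.

Lemma sign_holds_sg k x : sign_holds k (Num.sg x) = sign_holds k x.
Proof. by rewrite /sign_holds sgr_eq0 sgr_lt0. Qed.

Lemma decideP E : decide E <->
  exists2 a, size a = size (atoms_of E) &
    all (fun kp => sign_holds kp.1 (mpoly_at a kp.2)) (system E).
Proof.
have holdE a s : signs_hold (map fst s) [seq Num.sg (mpoly_at a p) | p <- map snd s] =
    all (fun kp => sign_holds kp.1 (mpoly_at a kp.2)) s.
  by elim: s => //= kp s ->; rewrite sign_holds_sg.
split.
  by case/hasP=> v /sign_vectorsP[a sa ->]; rewrite holdE => H; exists a.
case=> a sa H; apply/hasP.
exists [seq Num.sg (mpoly_at a p) | p <- map snd (system E)]; last by rewrite holdE.
by apply/sign_vectorsP; exists a.
Qed.

Lemma decide_atomsP E : decide E <-> exists P : seq bool -> R,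
  [/\ forall w, w \in atoms_of E -> 0 <= P w, \sum_(w <- atoms_of E) P w = 1 &
    all (fun g => sign_holds g.1 (mpoly_at
      [seq \sum_(w <- atoms_of E | tree_eval t w) P w | t <- E.2.2.2.1] g.2))
      E.2.2.2.2.1].
Proof.
have sysE P : all (fun kp => sign_holds kp.1 (mpoly_at (map P (atoms_of E)) kp.2))
    (system E) <-> [/\ forall w, w \in atoms_of E -> 0 <= P w,
    \sum_(w <- atoms_of E) P w = 1 &
    all (fun g => sign_holds g.1 (mpoly_at
      [seq \sum_(w <- atoms_of E | tree_eval t w) P w | t <- E.2.2.2.1] g.2))
      E.2.2.2.2.1].
  rewrite all_cat /= !all_map.
  have -> : all (preim (pair 2) (fun kp => sign_holds kp.1
      (mpoly_at [seq P i | i <- atoms_of E] kp.2))) (atom_polys (atoms_of E) [:: 1%N])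
      = all (fun w => 0 <= P w) (atoms_of E).
    have := atom_polys_at (atoms_of E) P [::] => /= H.
    rewrite -(all_map P (fun x => 0 <= x)) -{2}H all_map.
    by apply: eq_all => p /=; rewrite /sign_holds /= -leNgt.
  have -> : sign_holds 0 (mpoly_at [seq P i | i <- atoms_of E]
      ((-1, [::]) :: event_poly xpredT (atoms_of E) [:: 1%N])) =
      (\sum_(w <- atoms_of E) P w == 1).
    rewrite /sign_holds /= -cat1s mpoly_at_cat (event_poly_at _ _ _ [::]).
    by rewrite /mpoly_at big_seq1 monomial_at_nil mulr1 addrC subr_eq0.
  have -> : all (preim (fun g => (g.1, mpoly_subst
        [seq event_poly (tree_eval t) (atoms_of E) [:: 1%N] | t <- E.2.2.2.1] g.2))
      (fun kp => sign_holds kp.1 (mpoly_at [seq P i | i <- atoms_of E] kp.2)))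
      E.2.2.2.2.1 = all (fun g => sign_holds g.1 (mpoly_at
      [seq \sum_(w <- atoms_of E | tree_eval t w) P w | t <- E.2.2.2.1] g.2))
      E.2.2.2.2.1.
    apply: eq_all => g /=; rewrite mpoly_at_subst -map_comp; congr (sign_holds _ (mpoly_at _ _)).
    by apply: eq_map => t /=; rewrite (event_poly_at _ _ _ [::]).
  by split=> [/and3P[/allP ? /eqP ? ?]|[/allP ? /eqP ? ?]]; [|apply/and3P].
rewrite decideP; split=> [[a sa]|[P /sysE HP]]; last first.
  by exists (map P (atoms_of E)); rewrite // size_map.
(* The valuations are distinct, so a vector of unknowns is a function on them, read off by
   position. *)
pose P w := nth 0 a (index w (atoms_of E)).
have -> : a = map P (atoms_of E).
  apply: (@eq_from_nth _ 0); rewrite ?size_map // => i Hi.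
  by rewrite (nth_map [::]) -?sa // /P index_uniq -?sa // valuations_uniq.
by move/sysE => ?; exists P.
Qed.

End System.

(** * Consistency is solvability of the system *)

Section Consistency.
Variable R : realType.

Definition relation_tag (rel : relation0) : nat :=
  match rel with EqZero => 0 | NeqZero => 1 | GeqZero => 2 end.

Definition raw_requirement k s (g : requirement R k s) : nat * mpoly R :=
  (relation_tag (req_relation g),
   [seq (coefficient g rho, [seq nat_of_ord (rho j) | j : 'I_k])
   | rho : {ffun 'I_k -> 'I_s.+1}]).

(** The closing [tt] is encoded as the empty list, so that these nested pairs are encoded as the
    five-element list of [pre_environment_value]. *)
Definition raw_of (E : pre_environment R) :=
 
  (num_events E, (num_combinations E, (degree_bound E,
    ([seq tree_of_combination (combination j) | j : 'I_(num_combinations E)],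
     ([seq raw_requirement (requirement_at r) | r : 'I_(num_requirements E)],
      tt))))).

Lemma sign_holdsP rel (x : R) : sign_holds (relation_tag rel) x <-> holds0 rel x.
Proof.
case: rel; rewrite /sign_holds /= -?leNgt //.
  by split=> /eqP.
by split=> /eqP.
Qed.

Lemma raw_requirement_at k s (g : requirement R k s) (x : 'I_k -> R) :
  mpoly_at [seq x j | j : 'I_k] (raw_requirement g).2 = polynomial_value g x.
Proof.
rewrite /mpoly_at big_map big_enum; apply: eq_bigr => rho _ /=; congr (_ * _).
transitivity (\prod_(j <- enum 'I_k) x j ^+ rho j); last by rewrite big_enum.
by rewrite /image_mem; elim: (enum_mem _) => [|j s0 IH] /=; rewrite ?big_nil // big_cons IH.
Qed.

Lemma decide_rawP (E : pre_environment R) : decide (raw_of E) <->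
  exists P : seq bool -> R,
  [/\ forall w, w \in valuations (num_events E) -> 0 <= P w,
    \sum_(w <- valuations (num_events E)) P w = 1 &
    forall r : 'I_(num_requirements E),
      holds0 (req_relation (requirement_at r)) (polynomial_value (requirement_at r)
        (fun j => \sum_(w <- valuations (num_events E) |
                    combination_eval (combination j) w) P w))].
Proof.
have sumsE (P : seq bool -> R) :
    [seq \sum_(w <- atoms_of (raw_of E) | tree_eval t w) P w
    | t <- (raw_of E).2.2.2.1] =
    [seq \sum_(w <- valuations (num_events E) |
            combination_eval (combination j) w) P w | j : 'I_(num_combinations E)].
  rewrite -map_comp; apply: eq_map => j; apply: eq_bigl => w.
  exact: tree_of_combination_eval.
rewrite decide_atomsP; split=> -[P [H1 H2 H3]]; exists P; split => //; move: H3;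
  rewrite sumsE => H3.
  move=> r; rewrite -raw_requirement_at; apply/sign_holdsP.
  have rin : raw_requirement (requirement_at r) \in (raw_of E).2.2.2.2.1.
    by apply/fintype.imageP; exists r.
  exact: (allP H3 _ rin).
apply/allP => _ /fintype.imageP[r _ ->]; apply/sign_holdsP.
by rewrite raw_requirement_at; apply: H3.
Qed.

Section Atoms.
Variables (Omega : Type) (AA : set (set Omega)) (P : set Omega -> R).
Hypothesis AA_algebra : algebra_of_sets AA.
Hypothesis P_additive : finitely_additive AA P.

Lemma algebra_setC X : AA X -> AA (~` X)%classic.
Proof. by case: AA_algebra => _ H _; apply: H. Qed.

Lemma algebra_setU X Y : AA X -> AA Y -> AA (X `|` Y)%classic.
Proof. by case: AA_algebra => _ _ H; apply: H. Qed.

Lemma algebra_setI X Y : AA X -> AA Y -> AA (X `&` Y)%classic.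
Proof.
move=> AX AY; rewrite -[(_ `&` _)%classic]setCK setCI.
by apply/algebra_setC/algebra_setU; apply: algebra_setC.
Qed.

Lemma algebra_set0 : AA set0.
Proof. by case: AA_algebra. Qed.

Lemma algebra_setT : AA setT.
Proof. by rewrite -setC0; apply/algebra_setC/algebra_set0. Qed.

Fixpoint atom (As : seq (set Omega)) (w : seq bool) : set Omega :=
  if As is A :: As' then
    ((if head false w then A else ~` A) `&` atom As' (behead w))%classic
  else setT.

(** Additivity splits [X] along the first event and its complement; the remaining events split the
    two halves further. *)
Lemma sum_atoms (As : seq (set Omega)) X : (forall A, List.In A As -> AA A) -> AA X ->
  P X = \sum_(w <- valuations (size As)) P (X `&` atom As w)%classic.
Proof.
elim: As X => [|A As IH] X HAs AX /=; first by rewrite big_seq1 setIT.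
have AA_A : AA A by apply: HAs; left.
have HAs' B : List.In B As -> AA B by move=> ?; apply: HAs; right.
have split_X : P X = P (X `&` A)%classic + P (X `&` ~` A)%classic.
  rewrite -P_additive; last 3 first.
  - exact: algebra_setI.
  - by apply: algebra_setI => //; apply: algebra_setC.
  - by rewrite setIACA setICr setI0.
  by rewrite -setIUr setUCr setIT.
rewrite split_X big_cat !big_map /=; congr (_ + _); rewrite IH //.
- by apply: eq_bigr => w _ /=; rewrite setIA.
- exact: algebra_setI.
- by apply: eq_bigr => w _ /=; rewrite setIA.
- by apply: algebra_setI => //; apply: algebra_setC.
Qed.

Lemma atom_nth (As : seq (set Omega)) w i x : (i < size As)%N -> atom As w x ->
  nth set0 As i x <-> nth false w i.
Proof.
elim: As w i => [|A As IH] w [|i] //= Hi [].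
  by rewrite nth0; case: head.
by move=> _ /(IH _ _ Hi) ->; rewrite nth_behead.
Qed.

Lemma atom_event n (A : 'I_n -> set Omega) (B : boolean_combination n) w x :
  atom [seq A i | i : 'I_n] w x -> event A B x <-> combination_eval B w.
Proof.
move=> wx; elim: B => [i|B1 IH1|B1 IH1 B2 IH2|B1 IH1 B2 IH2||] //=.
- have := @atom_nth [seq A i | i : 'I_n] w i x; rewrite size_image card_ord.
  move=> /(_ (ltn_ord i) wx) <-.
  by rewrite (nth_map i) ?size_enum_ord // nth_ord_enum.
- by split=> [H|/negP H H']; [apply/negP => /IH1 | apply/H/IH1].
- by split=> [[/IH1 -> /IH2 ->]|/andP[/IH1 ? /IH2 ?]].
- by split=> [[/IH1|/IH2] -> //|/orP[/IH1|/IH2] ?]; rewrite ?orbT //; [left|right].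
Qed.

Lemma algebra_event n (A : 'I_n -> set Omega) (B : boolean_combination n) :
  (forall i, AA (A i)) -> AA (event A B).
Proof.
move=> HA; elim: B => [i|B1 IH1|B1 IH1 B2 IH2|B1 IH1 B2 IH2||] //=.
- exact: algebra_setC.
- exact: algebra_setI.
- exact: algebra_setU.
- exact: algebra_setT.
- exact: algebra_set0.
Qed.

End Atoms.

Lemma consistentP (E : pre_environment R) : decide (raw_of E) <-> consistent E.
Proof.
rewrite decide_rawP; set n := num_events E; split.
  move=> [P [P0 P1 HP]].
  (* The sample space is the set of all boolean lists with all its subsets, and the mass sits on the
     valuations of length [n]. *)
  pose mu (X : set (seq bool)) := \sum_(w <- valuations n | w \in X) P w.
  pose A (i : 'I_n) : set (seq bool) := [set w | nth false w i]%classic.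
  have eventP B w : event A B w <-> combination_eval B w.
    elim: B => [i|B1 IH1|B1 IH1 B2 IH2|B1 IH1 B2 IH2||] //=.
    - by split=> [H|/negP H H']; [apply/negP => /IH1 | apply/H/IH1].
    - by split=> [[/IH1 -> /IH2 ->]|/andP[/IH1 ? /IH2 ?]].
    - by split=> [[/IH1|/IH2] -> //|/orP[/IH1|/IH2] ?]; rewrite ?orbT //; [left|right].
  exists (seq bool), setT, mu, A; split => //.
  - split=> // [||X Y _ _ XY].
    + by rewrite /mu big_pred0 // => w; rewrite in_set0.
    + by rewrite -P1; apply: eq_bigl => w; rewrite in_setT.
    + rewrite /mu big_mkcond [leRHS]big_mkcond big_seq [leRHS]big_seq.
      apply: ler_sum => w wn; case: (boolP (w \in X)) => [|_].
        by rewrite in_setE => /XY XYw; rewrite ifT ?in_setE.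
      by case: ifP => // _; apply: P0.
  - move=> X Y _ _ XY; rewrite /mu big_mkcond [X in _ = X + _]big_mkcond.
    rewrite [X in _ = _ + X]big_mkcond -big_split; apply: eq_bigr => w _ /=.
    rewrite in_setU; case: (boolP (w \in X)); case: (boolP (w \in Y)) => /=.
    + rewrite !in_setE => Yw Xw; have : (X `&` Y)%classic w by [].
      by rewrite XY.
    + by rewrite addr0.
    + by rewrite add0r.
    + by rewrite addr0.
  - move=> r; have := HP r; congr (holds0 _ (polynomial_value _ _)).
    apply/funext => j; apply: eq_bigl => w.
    by apply/idP/idP; rewrite in_setE => /eventP.
move=> [Omega [AA [P [A [[AA0 AAT P0 P1 Pmono] alg add HA HE]]]]].
pose As := [seq A i | i : 'I_n].
have sAs : size As = n by rewrite size_image card_ord.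
have AAs X : List.In X As -> AA X.
  by rewrite /As /image_mem; elim: (enum_mem _) => //= i s IH [<-|/IH].
have atom_AA w : AA (atom As w).
  elim: (As) AAs w => [|X s IH] Hs w /=; first by [].
  apply: algebra_setI => //; last by apply: IH => Y ?; apply: Hs; right.
  have AX : AA X by apply: Hs; left.
  by case: ifP => // _; apply: algebra_setC.
have eventE B : P (event A B) =
    \sum_(w <- valuations n | combination_eval B w) P (atom As w).
  rewrite (sum_atoms alg add AAs); last exact: algebra_event.
  (* An atom lies inside the event or misses it; in the second case the intersection is empty and
     contributes [P set0 = 0]. *)
  rewrite sAs [RHS]big_mkcond; apply: eq_bigr => w _; case: ifP => Bw.
    congr (P _); apply/seteqP; split=> x; first by case.
    by move=> wx; split=> //; apply/(atom_event _ wx).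
  rewrite -P0; congr (P _); apply/seteqP; split=> x //.
  by case=> H wx; move/(atom_event _ wx): H; rewrite Bw.
exists (fun w => P (atom As w)); split.
- by move=> w _; rewrite -P0; apply: Pmono.
- by have := eventE BTrue; rewrite /= P1 => ->.
- move=> r; have := HE r; congr (holds0 _ (polynomial_value _ _)).
  by apply/funext => j; apply: eventE.
Qed.

End Consistency.

(** * Computable functions *)

Section Evaluation.
Variable R : realType.
Implicit Types (c p : program) (e : seq (value R)) (v w : value R).

Definition reaches (st st' : state R) : Prop :=
  exists m, iter m (obind (@step R)) (Some st) = Some st'.

Lemma reaches_refl st : reaches st st.
Proof. by exists 0%N. Qed.

Lemma reaches_trans st2 st1 st3 :
  reaches st1 st2 -> reaches st2 st3 -> reaches st1 st3.
Proof. by move=> [m Hm] [k Hk]; exists (k + m)%N; rewrite iterD Hm. Qed.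

Lemma reaches_step st st1 st2 :
  step st = Some st1 -> reaches st1 st2 -> reaches st st2.
Proof. by move=> H1; apply: reaches_trans; exists 1%N. Qed.

(** The quantification over the remaining code, the stack and the frames is what makes code
    fragments composable by concatenation. *)
Definition evals c e v : Prop := forall c' s f,
  reaches (State (c ++ c') e s f) (State c' e (v :: s) f).

Lemma evals1 i e v :
  (forall c' s f, step (State (i :: c') e s f) = Some (State c' e (v :: s) f)) ->
  evals [:: i] e v.
Proof. by move=> H c' s f; apply: reaches_step (H c' s f) (reaches_refl _). Qed.

Lemma evals_var i e v : onth e i = Some v -> evals [:: I_Var i] e v.
Proof. by move=> H; apply: evals1 => c' s f /=; rewrite H. Qed.

Lemma evals_one e : evals [:: I_One] e (VReal 1).
Proof. exact: evals1. Qed.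

Lemma evals_nil e : evals [:: I_Nil] e VNil.
Proof. exact: evals1. Qed.

Lemma evals_fun b e : evals [:: I_Fun b] e (VFun b e).
Proof. exact: evals1. Qed.

Lemma evals_op1 i c e v w :
  (forall c' s f,
     step (State (i :: c') e (v :: s) f) = Some (State c' e (w :: s) f)) ->
  evals c e v -> evals (c ++ [:: i]) e w.
Proof.
move=> H Hc c' s f; rewrite -catA; apply: reaches_trans (Hc _ _ _) _.
exact: reaches_step (H _ _ _) (reaches_refl _).
Qed.

Lemma evals_op2 i c1 c2 e v1 v2 w :
  (forall c' s f,
     step (State (i :: c') e (v2 :: v1 :: s) f) = Some (State c' e (w :: s) f)) ->
  evals c1 e v1 -> evals c2 e v2 -> evals (c1 ++ c2 ++ [:: i]) e w.
Proof.
move=> H H1 H2 c' s f; rewrite -!catA; apply: reaches_trans (H1 _ _ _) _.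
apply: reaches_trans (H2 _ _ _) _.
exact: reaches_step (H _ _ _) (reaches_refl _).
Qed.

Lemma evals_cons c1 c2 e v w :
  evals c1 e v -> evals c2 e w -> evals (c1 ++ c2 ++ [:: I_Cons]) e (VCons v w).
Proof. exact: evals_op2. Qed.

Lemma evals_return c e v c' e' s f :
  evals c e v -> reaches (State c e s ((c', e') :: f)) (State c' e' (v :: s) f).
Proof.
move=> H; have := H [::] s ((c', e') :: f); rewrite cats0 => H'.
exact: reaches_trans H' (reaches_step _ (reaches_refl _)).
Qed.

Lemma evals_case_nil c c1 c2 e v :
  evals c e VNil -> evals c1 e v -> evals (c ++ [:: I_Case c1 c2]) e v.
Proof.
move=> H H1 c' s f; rewrite -catA; apply: reaches_trans (H _ _ _) _.
exact: reaches_step (evals_return _ _ _ _ H1).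
Qed.

Lemma evals_case_cons c c1 c2 e v1 v2 v :
  evals c e (VCons v1 v2) -> evals c2 (v1 :: v2 :: e) v ->
  evals (c ++ [:: I_Case c1 c2]) e v.
Proof.
move=> H H1 c' s f; rewrite -catA; apply: reaches_trans (H _ _ _) _.
exact: reaches_step (evals_return _ _ _ _ H1).
Qed.

Lemma evals_pos c c1 c2 e x v :
  evals c e (VReal x) -> evals (if 0 < x then c1 else c2) e v ->
  evals (c ++ [:: I_Pos c1 c2]) e v.
Proof.
move=> H H1 c' s f; rewrite -catA; apply: reaches_trans (H _ _ _) _.
exact: reaches_step (evals_return _ _ _ _ H1).
Qed.

Lemma evals_app c1 c2 b e' e v w :
  evals c1 e (VFun b e') -> evals c2 e v ->
  evals b (v :: VFun b e' :: e') w -> evals (c1 ++ c2 ++ [:: I_App]) e w.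
Proof.
move=> H1 H2 H c' s f; rewrite -!catA; apply: reaches_trans (H1 _ _ _) _.
apply: reaches_trans (H2 _ _ _) _.
exact: reaches_step (evals_return _ _ _ _ H).
Qed.

(** The environment below the argument is arbitrary, so [p] can be called from inside any other
    body. *)
Definition runs p v w : Prop := forall e, evals p (v :: e) w.

Definition call p c : program := [:: I_Fun p] ++ c ++ [:: I_App].

Lemma evals_call p c e v w : runs p v w -> evals c e v -> evals (call p c) e w.
Proof. by move=> Hp Hc; apply: evals_app (evals_fun _ _) Hc (Hp _). Qed.

Definition tupc c1 c2 : program := c1 ++ c2 ++ [:: I_Cons].
Definition fstc c : program := c ++ [:: I_Case [::] [:: I_Var 0]].
Definition sndc c : program := c ++ [:: I_Case [::] [:: I_Var 1]].

Lemma evals_fst c e v w : evals c e (VCons v w) -> evals (fstc c) e v.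
Proof. by move=> H; apply: evals_case_cons H (evals_var _). Qed.

Lemma evals_snd c e v w : evals c e (VCons v w) -> evals (sndc c) e w.
Proof. by move=> H; apply: evals_case_cons H (evals_var _). Qed.

End Evaluation.

(** * Encodings and closure properties of computable functions *)

Class Enc (R : realType) (A : Type) := enc : A -> value R.

Section Encodings.
Variable R : realType.
Fixpoint enc_list A (EA : Enc R A) (s : seq A) : value R :=
  if s is x :: s' then VCons (EA x) (enc_list EA s') else VNil.
Global Instance Enc_real : Enc R R := @VReal R.
Global Instance Enc_nat : Enc R nat := @nat_value R.
Global Instance Enc_bool : Enc R bool := @bool_value R.
Global Instance Enc_unit : Enc R unit := fun=> VNil.
Global Instance Enc_seq A (EA : Enc R A) : Enc R (seq A) := enc_list EA.
Global Instance Enc_prod A B (EA : Enc R A) (EB : Enc R B) : Enc R (A * B) :=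
  fun x => VCons (enc x.1) (enc x.2).
End Encodings.

Definition computable (R : realType) A B (EA : Enc R A) (EB : Enc R B)
    (f : A -> B) : Prop :=
  exists p, forall a, runs p (EA a) (EB (f a)).

Arguments computable {R A B EA EB} f.

Section Closure.
Variable R : realType.
Notation Enc := (Enc R).

Section Generic.
Context {T A B : Type} {ET : Enc T} {EA : Enc A} {EB : Enc B}.

Lemma comp_id : computable (fun x : T => x).
Proof. by exists [:: I_Var 0] => a e; apply: evals_var. Qed.

Lemma comp_app (h : A -> B) (f : T -> A) :
  computable h -> computable f -> computable (fun x => h (f x)).
Proof.
move=> [ph Hh] [pf Hf]; exists (call ph pf) => a e.
exact: evals_call (Hh _) (Hf _ _).
Qed.

Lemma comp_pair (f : T -> A) (g : T -> B) :
  computable f -> computable g -> computable (fun x => (f x, g x)).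
Proof.
move=> [pf Hf] [pg Hg]; exists (tupc pf pg) => a e.
exact: evals_cons (Hf _ _) (Hg _ _).
Qed.

Lemma comp_fst (f : T -> A * B) : computable f -> computable (fun x => (f x).1).
Proof.
by move=> [pf Hf]; exists (fstc pf) => a e; apply: evals_fst (Hf a e).
Qed.

Lemma comp_snd (f : T -> A * B) : computable f -> computable (fun x => (f x).2).
Proof.
by move=> [pf Hf]; exists (sndc pf) => a e; apply: evals_snd (Hf a e).
Qed.

Lemma comp_nil : computable (fun _ : T => [::] : seq A).
Proof. by exists [:: I_Nil] => a e; apply: evals_nil. Qed.

Lemma comp_tt : computable (fun _ : T => tt).
Proof. by exists [:: I_Nil] => a e; apply: evals_nil. Qed.

Lemma comp_false : computable (fun _ : T => false).
Proof. by exists [:: I_Nil] => a e; apply: evals_nil. Qed.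

Lemma comp_true : computable (fun _ : T => true).
Proof.
exists (tupc [:: I_Nil] [:: I_Nil]) => a e.
by apply: evals_cons; apply: evals_nil.
Qed.

Lemma comp_O : computable (fun _ : T => 0%N).
Proof. by exists [:: I_Nil] => a e; apply: evals_nil. Qed.

Lemma comp_S (f : T -> nat) : computable f -> computable (fun x => (f x).+1).
Proof.
move=> [pf Hf]; exists (tupc [:: I_Nil] pf) => a e.
by apply: evals_cons; [apply: evals_nil | apply: Hf].
Qed.

Lemma comp_cons (f : T -> A) (g : T -> seq A) :
  computable f -> computable g -> computable (fun x => f x :: g x).
Proof.
move=> [pf Hf] [pg Hg]; exists (tupc pf pg) => a e.
exact: evals_cons (Hf _ _) (Hg _ _).
Qed.

Lemma comp_if (b : T -> bool) (f g : T -> A) :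
  computable b -> computable f -> computable g ->
  computable (fun x => if b x then f x else g x).
Proof.
move=> [pb Hb] [pf Hf] [pg Hg].
(* True is encoded as a nonempty list, so its branch runs with two extra variables bound and finds
   the argument at index 2. *)
exists (pb ++ [:: I_Case pg (call pf [:: I_Var 2])]) => a e.
have := Hb a e; case: (b a) => H.
  by apply: evals_case_cons H _; apply: evals_call (Hf _) _; apply: evals_var.
by apply: evals_case_nil H _; apply: Hg.
Qed.

Lemma comp_one : computable (fun _ : T => 1 : R).
Proof. by exists [:: I_One] => a e; apply: evals_one. Qed.

Lemma comp_add (f g : T -> R) :
  computable f -> computable g -> computable (fun x => f x + g x).
Proof.
move=> [pf Hf] [pg Hg]; exists (pf ++ pg ++ [:: I_Add]) => a e.
by apply: evals_op2 (Hf _ _) (Hg _ _).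
Qed.

Lemma comp_mul (f g : T -> R) :
  computable f -> computable g -> computable (fun x => f x * g x).
Proof.
move=> [pf Hf] [pg Hg]; exists (pf ++ pg ++ [:: I_Mul]) => a e.
by apply: evals_op2 (Hf _ _) (Hg _ _).
Qed.

Lemma comp_opp (f : T -> R) : computable f -> computable (fun x => - f x).
Proof.
move=> [pf Hf]; exists (pf ++ [:: I_Opp]) => a e.
by apply: evals_op1 (Hf _ _).
Qed.

Lemma comp_pos (f : T -> R) : computable f -> computable (fun x => 0 < f x).
Proof.
move=> [pf Hf].
exists (pf ++ [:: I_Pos (tupc [:: I_Nil] [:: I_Nil]) [:: I_Nil]]) => a e.
apply: evals_pos (Hf _ _) _; case: (0 < f a); last exact: evals_nil.
by apply: evals_cons; apply: evals_nil.
Qed.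

End Generic.

Lemma comp_app2 T A B C {ET : Enc T} {EA : Enc A} {EB : Enc B} {EC : Enc C}
    (h : A -> B -> C) (f : T -> A) (g : T -> B) :
  computable (fun t : A * B => h t.1 t.2) -> computable f -> computable g ->
  computable (fun x => h (f x) (g x)).
Proof. by move=> Hh Hf Hg; apply: comp_app Hh (comp_pair Hf Hg). Qed.

Section Recursion.
Context {T A S B : Type} {ET : Enc T} {EA : Enc A} {ES : Enc S}
  {EB : Enc B}.

(* The parameter s may change in the recursive call, so that functions that
   traverse two lists in parallel are instances. *)
Fixpoint list_recursion (F0 : T -> S -> B) (F1 : T -> A -> seq A -> S -> B -> B)
    (next : T -> A -> S -> S) (g : T) (l : seq A) (s : S) : B :=
  if l is a :: l' then
    F1 g a l' s (list_recursion F0 F1 next g l' (next g a s))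
  else F0 g s.

Lemma comp_list_recursion F0 F1 next :
  computable (fun t : T * S => F0 t.1 t.2) ->
  computable (fun t : T * (A * (seq A * (S * B))) =>
    F1 t.1 t.2.1 t.2.2.1 t.2.2.2.1 t.2.2.2.2) ->
  computable (fun t : T * (A * S) => next t.1 t.2.1 t.2.2) ->
  computable (fun t : T * (seq A * S) =>
    list_recursion F0 F1 next t.1 t.2.1 t.2.2).
Proof.
move=> [p0 H0] [p1 H1] [pn Hn].
pose V i := [:: I_Var i].
(* On entry, index 0 is the triple of parameters, list and state, and index 1 is the function
   itself. After the case split on a nonempty list, 0 and 1 are head and tail, 2 is the triple, and
   3 is the function for the recursive call. *)
pose body := fstc (sndc (V 0%N)) ++ [::
  I_Case (call p0 (tupc (fstc (V 0%N)) (sndc (sndc (V 0%N)))))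
   (call p1 (tupc (fstc (V 2%N)) (tupc (V 0%N) (tupc (V 1%N) (tupc
      (sndc (sndc (V 2%N)))
      (V 3%N ++ tupc (fstc (V 2%N)) (tupc (V 1%N)
         (call pn (tupc (fstc (V 2%N)) (tupc (V 0%N) (sndc (sndc (V 2%N)))))))
       ++ [:: I_App]))))))].
exists (call body (V 0%N)) => -[g [l s]] e /=.
apply: evals_app (evals_fun _ _) (evals_var _) _; first by [].
have VP i e' v : onth e' i = Some v -> evals (V i) e' v by exact: evals_var.
(* All recursive calls reuse the same closure, so its captured environment is fixed once before the
   induction. *)
move: (_ :: e) => {}e; elim: l s => [|a l IH] s.
  apply: evals_case_nil.
    by apply: evals_fst; apply: evals_snd; apply: VP.
  apply: evals_call (H0 (g, s)) _; apply: evals_cons.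
    by apply: evals_fst; apply: VP.
  by apply: evals_snd; apply: evals_snd; apply: VP.
apply: evals_case_cons.
  by apply: evals_fst; apply: evals_snd; apply: VP.
apply: evals_call (H1 (g, (a, (l, (s, _))))) _.
apply: evals_cons; first by apply: evals_fst; apply: VP.
apply: evals_cons; first exact: VP.
apply: evals_cons; first exact: VP.
apply: evals_cons; first by apply: evals_snd; apply: evals_snd; apply: VP.
apply: evals_app (IH _); first exact: VP.
apply: evals_cons; first by apply: evals_fst; apply: VP.
apply: evals_cons; first exact: VP.
apply: evals_call (Hn (g, (a, s))) _.
apply: evals_cons; first by apply: evals_fst; apply: VP.
apply: evals_cons; first exact: VP.
by apply: evals_snd; apply: evals_snd; apply: VP.
Qed.

(** Asks only for the recursion equations of [f], so that existing fixpoints qualify as they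
    stand. *)
Lemma comp_rec (F0 : T -> S -> B) (F1 : T -> A -> seq A -> S -> B -> B)
    (next : T -> A -> S -> S) (f : T -> seq A -> S -> B) (l : T -> seq A)
    (s : T -> S) :
  (forall x s, f x [::] s = F0 x s) ->
  (forall x a l s, f x (a :: l) s = F1 x a l s (f x l (next x a s))) ->
  computable (fun t : T * S => F0 t.1 t.2) ->
  computable (fun t : T * (A * (seq A * (S * B))) =>
    F1 t.1 t.2.1 t.2.2.1 t.2.2.2.1 t.2.2.2.2) ->
  computable (fun t : T * (A * S) => next t.1 t.2.1 t.2.2) ->
  computable l -> computable s -> computable (fun x => f x (l x) (s x)).
Proof.
move=> f0 f1 H0 H1 Hn Hl Hs.
have -> : (fun x => f x (l x) (s x)) =
    (fun x => (fun t => list_recursion F0 F1 next t.1 t.2.1 t.2.2)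
                (x, (l x, s x))).
  apply/funext => x /=; move: (l x) (s x); elim=> [|a l' IH] s' /=.
    exact: f0.
  by rewrite f1 IH.
apply: (comp_app (h := fun t : T * (seq A * S) =>
    list_recursion F0 F1 next t.1 t.2.1 t.2.2)); first exact: comp_list_recursion.
by apply: comp_pair; [exact: comp_id | exact: comp_pair].
Qed.

End Recursion.

Section Lists.
Context {T A B : Type} {ET : Enc T} {EA : Enc A} {EB : Enc B}.

Lemma comp_foldr (F : T -> A -> B -> B) (z : T -> B) (l : T -> seq A) :
  computable (fun t : T * (A * B) => F t.1 t.2.1 t.2.2) ->
  computable z -> computable l ->
  computable (fun x => foldr (F x) (z x) (l x)).
Proof.
move=> HF Hz Hl.
apply: (@comp_rec _ A B B _ _ _ _ (fun _ s => s)
          (fun x a _ _ b => F x a b) (fun _ _ s => s)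
          (fun x l s => foldr (F x) s l)) => //.
- exact: (comp_snd comp_id).
- apply: (comp_app (h := fun t : T * (A * B) => F t.1 t.2.1 t.2.2)
    (f := fun t => (t.1, (t.2.1, t.2.2.2.2)))) => //.
  apply: comp_pair; first exact: (comp_fst comp_id).
  apply: comp_pair; first exact: (comp_fst (comp_snd comp_id)).
  exact: (comp_snd (comp_snd (comp_snd (comp_snd comp_id)))).
- exact: (comp_snd (comp_snd comp_id)).
Qed.

Lemma comp_head (z : T -> A) (l : T -> seq A) :
  computable z -> computable l -> computable (fun x => head (z x) (l x)).
Proof.
move=> Hz Hl.
apply: (@comp_rec _ A A A _ _ _ _ (fun _ s => s)
          (fun _ a _ _ _ => a) (fun _ _ s => s)
          (fun _ l s => head s l)) => //.
- exact: (comp_snd comp_id).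
- exact: (comp_fst (comp_snd comp_id)).
- exact: (comp_snd (comp_snd comp_id)).
Qed.

Lemma comp_behead (l : T -> seq A) :
  computable l -> computable (fun x => behead (l x)).
Proof.
move=> Hl.
apply: (@comp_rec _ A unit _ _ _ _ _ (fun _ _ => [::])
          (fun _ _ l _ _ => l) (fun _ _ s => s)
          (fun _ l _ => behead l) l (fun=> tt)) => //.
- exact: comp_nil.
- exact: (comp_fst (comp_snd (comp_snd comp_id))).
- exact: (comp_snd (comp_snd comp_id)).
- exact: comp_tt.
Qed.

End Lists.

End Closure.

(* A goal [computable (fun x => g (f x))] is closed by recursion on the term.
   The hints dispatch on the syntactic head instead of being lemmas, because
   unification up to conversion is too slow here; the first one undoes the
   eta-contractions that unification leaves behind. *)
Create HintDb comp.
#[global] Hint Extern 0 (@computable ?R ?A ?B ?EA ?EB ?f) =>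
  lazymatch f with
  | (fun _ => _) => fail
  | _ => change (@computable R A B EA EB (fun x => f x))
  end : comp.
#[global] Hint Extern 0 (computable _) =>
  match goal with
  | H : @computable _ _ _ _ _ ?f |- computable (fun x => ?f (@?g x)) =>
    simple apply (@comp_app _ _ _ _ _ _ _ f g H)
  | H : @computable _ _ _ _ _ (fun t => ?h t.1 t.2)
    |- computable (fun x => ?h (@?f x) (@?g x)) =>
    simple apply (@comp_app2 _ _ _ _ _ _ _ _ _ h f g H)
  end : comp.
#[global] Hint Extern 1 (computable _) =>
  lazymatch goal with
  | |- computable (fun x => x) => simple apply comp_id
  | |- computable (fun x => (_, _)) => simple apply comp_pair
  | |- computable (fun x => fst _) => simple eapply comp_fst
  | |- computable (fun x => snd _) => simple eapply comp_snd
  | |- computable (fun x => match @?b x with true => @?f x | false => @?g x end) =>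
    simple apply (@comp_if _ _ _ _ _ b f g)
  | |- computable (fun x => [::]) => simple apply comp_nil
  | |- computable (fun x => cons _ _) => simple apply comp_cons
  | |- computable (fun x => tt) => simple apply comp_tt
  | |- computable (fun x => true) => simple apply comp_true
  | |- computable (fun x => false) => simple apply comp_false
  | |- computable (fun x => O) => simple apply comp_O
  | |- computable (fun x => S _) => simple apply comp_S
  | |- computable (fun x => GRing.one _) => simple apply comp_one
  | |- computable (fun x => GRing.add _ _) => simple apply comp_add
  | |- computable (fun x => GRing.mul _ _) => simple apply comp_mul
  | |- computable (fun x => GRing.opp _) => simple apply comp_opp
  | |- computable (fun x => @Order.lt _ _ (@GRing.zero _) _) => simple apply comp_pos
  | |- computable (fun x => head _ _) => simple apply comp_head
  | |- computable (fun x => behead _) => simple apply comp_behead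
  | |- computable (fun x => foldr _ _ _) => simple eapply comp_foldr
  end : comp.
Ltac comp := typeclasses eauto with comp nocore.

(** * Recursion on trees and numbers, and the standard list functions *)

Section Basic.
Variable R : realType.
Notation Enc := (Enc R).

Section TreeFold.
Context {T D : Type} {ET : Enc T} {ED : Enc D}.

Fixpoint enc_tree (t : tree) : value R :=
  if t is TCons t1 t2 then VCons (enc_tree t1) (enc_tree t2) else VNil.
Global Instance Enc_tree : Enc tree := enc_tree.

Lemma comp_tree_rec (F0 : T -> D) (F1 : T -> D -> D -> D) (f : T -> tree -> D)
    (g : T -> tree) :
  (forall x, f x TNil = F0 x) ->
  (forall x t1 t2, f x (TCons t1 t2) = F1 x (f x t1) (f x t2)) ->
  computable F0 -> computable (fun t : T * (D * D) => F1 t.1 t.2.1 t.2.2) ->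
  computable g -> computable (fun x => f x (g x)).
Proof.
move=> f0 f1 [p0 H0] [p1 H1] Hg.
suff: @computable R _ _ (Enc_prod ET Enc_tree) ED (fun s : T * tree => f s.1 s.2).
  by move=> Hf; apply: (comp_app2 (h := f) Hf) => //; apply: comp_id.
pose V i := [:: I_Var i].
(* The recursive call on the subtree at index [i]; after the case split the function is at index 3
   and its argument pair at index 2. *)
pose rc i := V 3%N ++ tupc (fstc (V 2%N)) (V i) ++ [:: I_App].
pose body := sndc (V 0%N) ++ [:: I_Case (call p0 (fstc (V 0%N)))
  (call p1 (tupc (fstc (V 2%N)) (tupc (rc 0%N) (rc 1%N))))].
exists (call body (V 0%N)) => -[x t] e /=.
apply: evals_app (evals_fun _ _) (evals_var _) _; first by [].
have VP i e' v : onth e' i = Some v -> evals (V i) e' v by exact: evals_var.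
move: (_ :: e) => {}e; elim: t => [|t1 IH1 t2 IH2].
  apply: evals_case_nil; first by apply: evals_snd; apply: VP.
  by rewrite f0; apply: evals_call (H0 x) _; apply: evals_fst; apply: VP.
apply: evals_case_cons; first by apply: evals_snd; apply: VP.
rewrite f1; apply: evals_call (H1 (x, (_, _))) _.
apply: evals_cons; first by apply: evals_fst; apply: VP.
apply: evals_cons; [apply: evals_app IH1 | apply: evals_app IH2]; try exact: VP;
  by apply: evals_cons; [apply: evals_fst; apply: VP | apply: VP].
Qed.

End TreeFold.

(* A natural number and the list of so many units have the same encoding, so that
   recursion on numbers reduces to recursion on lists. *)
Lemma comp_nseq_unit : computable (R := R) (fun n : nat => nseq n tt).
Proof.
exists [:: I_Var 0] => n e; apply: evals_var => /=; congr Some.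
by rewrite /Enc_nat /nat_value /Enc_seq; elim: n => //= n ->.
Qed.

Lemma comp_size_unit : computable (R := R) (fun s : seq unit => size s).
Proof.
exists [:: I_Var 0] => s e; apply: evals_var => /=; congr Some.
by rewrite /Enc_nat /nat_value /Enc_seq; elim: s => //= -[] s ->.
Qed.

Section Generic.
Context {T A B S : Type} {ET : Enc T} {EA : Enc A} {EB : Enc B} {ES : Enc S}.

Lemma comp_nat_rec (F0 : T -> S -> B) (F1 : T -> nat -> S -> B -> B)
    (next : T -> S -> S) (f : T -> nat -> S -> B) (n : T -> nat) (s : T -> S) :
  (forall x s, f x 0%N s = F0 x s) ->
  (forall x n s, f x n.+1 s = F1 x n s (f x n (next x s))) ->
  computable (fun t : T * S => F0 t.1 t.2) ->
  computable (fun t : T * (nat * (S * B)) => F1 t.1 t.2.1 t.2.2.1 t.2.2.2) ->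
  computable (fun t : T * S => next t.1 t.2) ->
  computable n -> computable s -> computable (fun x => f x (n x) (s x)).
Proof.
move=> f0 f1 H0 H1 Hn Hnn Hs.
have -> : (fun x => f x (n x) (s x)) =
    (fun x => (fun x l s => f x (size l) s) x (nseq (n x) tt) (s x)).
  by apply/funext => x; rewrite size_nseq.
apply: (@comp_rec _ _ unit _ _ _ _ _ _ F0
  (fun x _ l s b => F1 x (size l) s b) (fun x _ s => next x s)
  (fun x l s => f x (size l) s)) => //.
- by move=> x a l s0; exact: f1.
- apply: (comp_app (h := fun t : T * (nat * (S * B)) => F1 t.1 t.2.1 t.2.2.1 t.2.2.2)
    (f := fun t : T * (unit * (seq unit * (S * B))) =>
            (t.1, (size t.2.2.1, t.2.2.2)))) => //.
  apply: comp_pair; first by comp.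
  apply: comp_pair; last by comp.
  by apply: (comp_app comp_size_unit); comp.
- apply: (comp_app (h := fun t : T * S => next t.1 t.2)
    (f := fun t : T * (unit * S) => (t.1, t.2.2))) => //; comp.
- exact: comp_app comp_nseq_unit Hnn.
Qed.

Lemma comp_list_iter (F0 : T -> B) (F1 : T -> A -> seq A -> B -> B)
    (f : T -> seq A -> B) (l : T -> seq A) :
  (forall x, f x [::] = F0 x) ->
  (forall x a l, f x (a :: l) = F1 x a l (f x l)) ->
  computable F0 ->
  computable (fun t : T * (A * (seq A * B)) => F1 t.1 t.2.1 t.2.2.1 t.2.2.2) ->
  computable l -> computable (fun x => f x (l x)).
Proof.
move=> f0 f1 H0 H1 Hl.
apply: (@comp_rec _ _ _ unit _ _ _ _ _ (fun x _ => F0 x)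
  (fun x a l _ b => F1 x a l b) (fun _ _ s => s) (fun x l _ => f x l) l (fun=> tt)) => //.
- by apply: (comp_app H0); comp.
- apply: (comp_app (h := fun t : T * (A * (seq A * B)) => F1 t.1 t.2.1 t.2.2.1 t.2.2.2)
    (f := fun t : T * (A * (seq A * (unit * B))) =>
            (t.1, (t.2.1, (t.2.2.1, t.2.2.2.2))))) => //; comp.
- comp.
- comp.
Qed.

End Generic.

Section Lists.
Context {T A B : Type} {ET : Enc T} {EA : Enc A} {EB : Enc B}.

Lemma comp_size (l : T -> seq A) : computable l -> computable (fun x => size (l x)).
Proof.
apply: (comp_list_iter (F0 := fun=> 0%N) (F1 := fun _ _ _ n => n.+1)
  (f := fun _ l => size l)) => //; comp.
Qed.

Lemma comp_nilp (l : T -> seq A) : computable l -> computable (fun x => nilp (l x)).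
Proof.
apply: (comp_list_iter (F0 := fun=> true) (F1 := fun _ _ _ _ => false)
  (f := fun _ l => nilp l)) => //; comp.
Qed.

Lemma comp_cat (l1 l2 : T -> seq A) :
  computable l1 -> computable l2 -> computable (fun x => l1 x ++ l2 x).
Proof.
move=> H1 H2; apply: (comp_list_iter (F0 := l2) (F1 := fun _ a _ s => a :: s)
  (f := fun x l => l ++ l2 x)) => //; comp.
Qed.

Lemma comp_map (f : T -> A -> B) (l : T -> seq A) :
  computable (fun t : T * A => f t.1 t.2) -> computable l ->
  computable (fun x => map (f x) (l x)).
Proof.
move=> Hf; apply: (comp_list_iter (F0 := fun=> [::]) (F1 := fun x a _ s => f x a :: s)
  (f := fun x l => map (f x) l)) => //; first by comp.
apply: comp_cons; last by comp.
by apply: (comp_app2 (h := f) Hf); comp.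
Qed.

Lemma comp_filter (f : T -> A -> bool) (l : T -> seq A) :
  computable (fun t : T * A => f t.1 t.2) -> computable l ->
  computable (fun x => filter (f x) (l x)).
Proof.
move=> Hf; apply: (comp_list_iter (F0 := fun=> [::])
  (F1 := fun x a _ s => if f x a then a :: s else s)
  (f := fun x l => filter (f x) l)) => //; first by comp.
apply: comp_if; [|by comp|by comp].
by apply: (comp_app2 (h := f) Hf); comp.
Qed.

Lemma comp_has (f : T -> A -> bool) (l : T -> seq A) :
  computable (fun t : T * A => f t.1 t.2) -> computable l ->
  computable (fun x => has (f x) (l x)).
Proof.
move=> Hf; apply: (comp_list_iter (F0 := fun=> false)
  (F1 := fun x a _ s => if f x a then true else s)
  (f := fun x l => has (f x) l)) => //; first by comp.
apply: comp_if; [|by comp|by comp].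
by apply: (comp_app2 (h := f) Hf); comp.
Qed.

Lemma comp_nth (z : T -> A) (l : T -> seq A) (n : T -> nat) :
  computable z -> computable l -> computable n ->
  computable (fun x => nth (z x) (l x) (n x)).
Proof.
move=> Hz Hl Hn.
apply: (@comp_nat_rec _ _ (seq A) _ _ _ (fun x s => head (z x) s)
  (fun _ _ _ b => b) (fun _ s => behead s) (fun x n s => nth (z x) s n)) => //.
- by move=> x k; case=> //= ; rewrite nth_nil.
- apply: comp_head; last by comp.
  by apply: (comp_app Hz); comp.
- comp.
- apply: comp_behead; comp.
Qed.

Lemma comp_iter (f : T -> A -> A) (n : T -> nat) (z : T -> A) :
  computable (fun t : T * A => f t.1 t.2) -> computable n -> computable z ->
  computable (fun x => iter (n x) (f x) (z x)).
Proof.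
move=> Hf Hn Hz; apply: (@comp_nat_rec _ _ A _ _ _ (fun _ s => s)
  (fun x _ _ b => f x b) (fun _ s => s) (fun x n s => iter n (f x) s)) => //.
- comp.
- by apply: (comp_app2 (h := f) Hf); comp.
- comp.
Qed.

End Lists.

Lemma comp_flatten {T A} {ET : Enc T} {EA : Enc A} (l : T -> seq (seq A)) :
  computable l -> computable (fun x => flatten (l x)).
Proof.
apply: (comp_list_iter (F0 := fun=> [::]) (F1 := fun _ a _ s => a ++ s)
  (f := fun x l => flatten l)) => //; first by comp.
by apply: comp_cat; comp.
Qed.

End Basic.
#[global] Hint Extern 1 (computable _) =>
  lazymatch goal with
  | |- computable (fun x => size _) => simple eapply comp_size
  | |- computable (fun x => nilp _) => simple eapply comp_nilp
  | |- computable (fun x => cat _ _) => simple apply comp_cat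
  | |- computable (fun x => map _ _) => simple eapply comp_map
  | |- computable (fun x => filter _ _) => simple apply comp_filter
  | |- computable (fun x => has _ _) => simple eapply comp_has
  | |- computable (fun x => nth _ _ _) => simple apply comp_nth
  | |- computable (fun x => iter _ _ _) => simple apply comp_iter
  | |- computable (fun x => flatten _) => simple apply comp_flatten
  end : comp.

(** * Computability of booleans, arithmetic and comparisons *)

Section Arithmetic.
Variable R : realType.
Context {T : Type} {ET : Enc R T}.

Lemma comp_negb (b : T -> bool) : computable b -> computable (fun x => ~~ b x).
Proof.
move=> Hb; have -> : (fun x => ~~ b x) = (fun x => if b x then false else true).
  by apply/funext => x; case: (b x).
comp.
Qed.

Lemma comp_andb (b c : T -> bool) :
  computable b -> computable c -> computable (fun x => b x && c x).
Proof.
move=> Hb Hc; have -> : (fun x => b x && c x) = (fun x => if b x then c x else false).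
  by apply/funext => x; case: (b x).
comp.
Qed.

Lemma comp_orb (b c : T -> bool) :
  computable b -> computable c -> computable (fun x => b x || c x).
Proof.
move=> Hb Hc; have -> : (fun x => b x || c x) = (fun x => if b x then true else c x).
  by apply/funext => x; case: (b x).
comp.
Qed.

Lemma comp_addn (m n : T -> nat) :
  computable m -> computable n -> computable (fun x => (m x + n x)%N).
Proof.
move=> Hm Hn; apply: (@comp_nat_rec _ _ _ unit _ _ _ (fun x _ => n x)
  (fun _ _ _ b => b.+1) (fun _ s => s) (fun x m _ => (m + n x)%N) m (fun=> tt)) => //.
- by apply: (comp_app Hn); comp.
- comp.
- comp.
- comp.
Qed.

Lemma comp_predn (n : T -> nat) : computable n -> computable (fun x => (n x).-1).
Proof.
move=> Hn; apply: (@comp_nat_rec _ _ _ unit _ _ _ (fun _ _ => 0%N)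
  (fun _ n _ _ => n) (fun _ s => s) (fun _ n _ => n.-1) n (fun=> tt)) => //; comp.
Qed.

Lemma comp_eqn0 (n : T -> nat) : computable n -> computable (fun x => n x == 0%N).
Proof.
move=> Hn; apply: (@comp_nat_rec _ _ _ unit _ _ _ (fun _ _ => true)
  (fun _ n _ _ => false) (fun _ s => s) (fun _ n _ => n == 0%N) n (fun=> tt)) => //; comp.
Qed.

End Arithmetic.

#[global] Hint Extern 1 (computable _) =>
  lazymatch goal with
  | |- computable (fun x => negb _) => simple apply comp_negb
  | |- computable (fun x => andb _ _) => simple apply comp_andb
  | |- computable (fun x => orb _ _) => simple apply comp_orb
  | |- computable (fun x => addn _ _) => simple apply comp_addn
  | |- computable (fun x => predn _) => simple apply comp_predn
  | |- computable (fun x => eq_op _ O) => simple apply comp_eqn0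
  end : comp.

Section Comparison.
Variable R : realType.
Context {T : Type} {ET : Enc R T}.

Lemma comp_subn (m n : T -> nat) :
  computable m -> computable n -> computable (fun x => (m x - n x)%N).
Proof.
move=> Hm Hn; have -> : (fun x => (m x - n x)%N) = (fun x => iter (n x) predn (m x)).
  by apply/funext => x; elim: (n x) => [|k IH] /=; rewrite ?subn0 // subnS IH.
comp.
Qed.
Hint Extern 1 (computable (fun x => subn _ _)) => simple apply comp_subn : comp.

Lemma comp_leq (m n : T -> nat) :
  computable m -> computable n -> computable (fun x => (m x <= n x)%N).
Proof. by move=> Hm Hn; rewrite /leq; comp. Qed.
Hint Extern 1 (computable (fun x => leq _ _)) => simple apply comp_leq : comp.

Lemma comp_eqn (m n : T -> nat) :
  computable m -> computable n -> computable (fun x => m x == n x).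
Proof.
move=> Hm Hn; have -> : (fun x => m x == n x) = (fun x => (m x <= n x <= m x)%N).
  by apply/funext => x; rewrite eqn_leq.
comp.
Qed.

Lemma comp_zero : computable (fun _ : T => 0 : R).
Proof.
have -> : (fun _ : T => 0 : R) = (fun _ => 1 + - 1) by apply/funext => x; rewrite subrr.
comp.
Qed.
Hint Extern 1 (computable (fun x => @GRing.zero _)) => simple apply comp_zero : comp.

Lemma comp_natr (n : T -> nat) : computable n -> computable (fun x => (n x)%:R : R).
Proof.
move=> Hn; have -> : (fun x => (n x)%:R : R) =
    (fun x => iter (n x) (fun y => 1 + y) 0).
  by apply/funext => x; elim: (n x) => //= k <-; rewrite mulrS.
comp.
Qed.

Lemma comp_exprn (f : T -> R) (n : T -> nat) :
  computable f -> computable n -> computable (fun x => f x ^+ n x).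
Proof.
move=> Hf Hn; have -> : (fun x => f x ^+ n x) = (fun x => iter (n x) (fun y => f x * y) 1).
  by apply/funext => x; elim: (n x) => //= k <-; rewrite exprS.
apply: comp_iter => //; last by comp.
by apply: comp_mul; [apply: (comp_app Hf)|]; comp.
Qed.

Lemma comp_ltr (f g : T -> R) :
  computable f -> computable g -> computable (fun x => f x < g x).
Proof.
move=> Hf Hg; have -> : (fun x => f x < g x) = (fun x => 0 < g x + - f x).
  by apply/funext => x; rewrite subr_gt0.
comp.
Qed.
Hint Extern 1 (computable (fun x => Order.lt _ _)) => simple apply comp_ltr : comp.

(** Two strict comparisons decide equality, hence finitely many sign tests decide equality of
    polynomials, on which [lookup] relies. *)
Lemma comp_eqr (f g : T -> R) :
  computable f -> computable g -> computable (fun x => f x == g x).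
Proof.
move=> Hf Hg; have -> : (fun x => f x == g x) = (fun x => ~~ (f x < g x) && ~~ (g x < f x)).
  by apply/funext => x; rewrite -!leNgt eq_le andbC.
comp.
Qed.
Hint Extern 1 (computable (fun x => @eq_op _ _ _)) => simple apply comp_eqr : comp.

Lemma comp_sgr (f : T -> R) : computable f -> computable (fun x => Num.sg (f x)).
Proof.
move=> Hf; rewrite /Num.sg; comp.
Qed.
End Comparison.

#[global] Hint Extern 1 (computable _) =>
  lazymatch goal with
  | |- computable (fun x => subn _ _) => simple apply comp_subn
  | |- computable (fun x => leq _ _) => simple apply comp_leq
  | |- computable (fun x => @eq_op _ _ _) =>
    first [simple apply comp_eqn | simple apply comp_eqr]
  | |- computable (fun x => @GRing.zero _) => simple apply comp_zero
  | |- computable (fun x => GRing.natmul _ _) => simple apply comp_natr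
  | |- computable (fun x => GRing.exp _ _) => simple apply comp_exprn
  | |- computable (fun x => Order.lt _ _) => simple apply comp_ltr
  | |- computable (fun x => Num.sg _) => simple apply comp_sgr
  end : comp.

Section Equality.
Variable R : realType.
Context {T : Type} {ET : Enc R T}.

Lemma comp_eq_seq (A : eqType) {EA : Enc R A} (s t : T -> seq A) :
  computable (fun p : A * A => p.1 == p.2) ->
  computable s -> computable t -> computable (fun x => s x == t x).
Proof.
move=> Heq Hs Ht.
apply: (@comp_rec _ _ A (seq A) _ _ _ _ _ (fun _ t => nilp t)
  (fun _ a _ t b => if nilp t then false else (a == head a t) && b)
  (fun _ _ t => behead t) (fun _ s t => s == t)) => //.
- by move=> _ [].
- by move=> x a l [].
- comp.
- comp.
- comp.
Qed.

Lemma comp_eq_pair (A B : eqType) {EA : Enc R A} {EB : Enc R B} (f g : T -> A * B) :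
  computable (fun p : A * A => p.1 == p.2) ->
  computable (fun p : B * B => p.1 == p.2) ->
  computable f -> computable g -> computable (fun x => f x == g x).
Proof.
move=> HA HB Hf Hg.
have -> : (fun x => f x == g x) = (fun x => ((f x).1 == (g x).1) && ((f x).2 == (g x).2)).
  by apply/funext => x; case: (f x) => a b; case: (g x) => c d; apply: xpair_eqE.
comp.
Qed.

Lemma comp_lookup (A : eqType) {EA : Enc R A} (a : T -> A) (l : T -> seq A)
    (v : T -> seq R) :
  computable (fun p : A * A => p.1 == p.2) ->
  computable a -> computable l -> computable v ->
  computable (fun x => lookup (a x) (l x) (v x)).
Proof.
move=> Heq Ha Hl Hv.
apply: (@comp_rec _ _ A (seq R) _ _ _ _ _ (fun _ _ => 0)
  (fun x b _ v r => if a x == b then head 0 v else r)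
  (fun _ _ v => behead v) (fun x l v => lookup (a x) l v)) => //; try by comp.
Qed.

End Equality.

Section PolynomialEquality.
Variable R : realType.
Notation mpoly := (mpoly R).
Notation upoly := (upoly R).

Lemma comp_eq_mpoly : computable (R := R) (fun p : mpoly * mpoly => p.1 == p.2).
Proof.
apply: comp_eq_seq; [|by comp|by comp].
apply: comp_eq_pair; [by comp| |by comp|by comp].
by apply: comp_eq_seq; comp.
Qed.

Lemma comp_eq_upoly : computable (R := R) (fun p : upoly * upoly => p.1 == p.2).
Proof. by apply: comp_eq_seq; [exact: comp_eq_mpoly | comp | comp]. Qed.

Context {T : Type} {ET : Enc R T}.

Lemma comp_add_exponents (e f : T -> seq nat) :
  computable e -> computable f -> computable (fun x => add_exponents (e x) (f x)).
Proof.
apply: (@comp_rec _ _ nat (seq nat) _ _ _ _ _ (fun _ f => f)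
  (fun x i _ f r => (i + head 0%N f)%N :: r)
  (fun _ _ f => behead f) (fun x e f => add_exponents e f)) => //; comp.
Qed.

Lemma comp_mpoly_scale (c : T -> R) (p : T -> mpoly) :
  computable c -> computable p -> computable (fun x => mpoly_scale (c x) (p x)).
Proof.
move=> Hc Hp; rewrite /mpoly_scale; comp.
Qed.

End PolynomialEquality.

#[global] Hint Extern 1 (computable _) =>
  lazymatch goal with
  | |- computable (fun x => add_exponents _ _) => simple apply comp_add_exponents
  | |- computable (fun x => mpoly_scale _ _) => simple apply comp_mpoly_scale
  | |- computable (fun x => lookup _ _ _) => simple eapply comp_lookup;
      [first [simple apply comp_eq_mpoly | simple apply comp_eq_upoly]| | |]
  end : comp.

(** * Computability of the elimination method *)

Section CompPolynomials.
Variable R : realType.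
Notation mpoly := (mpoly R).
Notation upoly := (upoly R).
Context {T : Type} {ET : Enc R T}.

Lemma comp_mpoly_mul (p q : T -> mpoly) :
  computable p -> computable q -> computable (fun x => mpoly_mul (p x) (q x)).
Proof. by move=> Hp Hq; rewrite /mpoly_mul; comp. Qed.

Lemma comp_mpoly_coef (k : T -> nat) (p : T -> mpoly) :
  computable k -> computable p -> computable (fun x => mpoly_coef (k x) (p x)).
Proof.
move=> Hk Hp; rewrite /mpoly_coef; comp.
Qed.

Lemma comp_degree_bound1 (p : T -> mpoly) :
  computable p -> computable (fun x => degree_bound1 (p x)).
Proof. by move=> Hp; rewrite /degree_bound1; comp. Qed.

Lemma comp_upoly_deriv (u : T -> upoly) :
  computable u -> computable (fun x => upoly_deriv (u x)).
Proof.
move=> Hu; apply: (comp_list_iter (F0 := fun=> [::])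
  (F1 := fun _ c u r => if nilp u then [::] else mpoly_scale (size u)%:R c :: r)
  (f := fun _ u => upoly_deriv u)) => //; comp.
Qed.

End CompPolynomials.

#[global] Hint Extern 1 (computable _) =>
  lazymatch goal with
  | |- computable (fun x => mpoly_mul _ _) => simple apply comp_mpoly_mul
  | |- computable (fun x => mpoly_coef _ _) => simple apply comp_mpoly_coef
  | |- computable (fun x => degree_bound1 _) => simple apply comp_degree_bound1
  | |- computable (fun x => upoly_deriv _) => simple apply comp_upoly_deriv
  end : comp.

Section CompUnivariate.
Variable R : realType.
Notation mpoly := (mpoly R).
Notation upoly := (upoly R).
Context {T : Type} {ET : Enc R T}.

Lemma comp_univariate (p : T -> mpoly) :
  computable p -> computable (fun x => univariate (p x)).
Proof.
move=> Hp; apply: (@comp_nat_rec _ _ _ mpoly _ _ _ (fun _ p => [:: mpoly_coef 0 p])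
  (fun _ k p u => mpoly_coef k.+1 p :: u) (fun _ p => p)
  (fun _ k p => mpoly_coefs k p) (fun x => degree_bound1 (p x)) p) => //; comp.
Qed.

Lemma comp_cross_combine (b c : T -> mpoly) (u w : T -> upoly) :
  computable b -> computable c -> computable u -> computable w ->
  computable (fun x => cross_combine (b x) (c x) (u x) (w x)).
Proof.
move=> Hb Hc Hu Hw; apply: (@comp_rec _ _ mpoly upoly _ _ _ _ _ (fun _ _ => [::])
  (fun x d _ w r => (mpoly_mul (b x) (mpoly_mul (b x) d) ++
       mpoly_scale (-1) (mpoly_mul (b x) (mpoly_mul (c x) (head [::] w)))) :: r)
  (fun _ _ w => behead w) (fun x u w => cross_combine (b x) (c x) u w)) => //; comp.
Qed.

End CompUnivariate.

#[global] Hint Extern 1 (computable _) =>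
  lazymatch goal with
  | |- computable (fun x => univariate _) => simple apply comp_univariate
  | |- computable (fun x => cross_combine _ _ _ _) => simple apply comp_cross_combine
  end : comp.

Section CompReduction.
Variable R : realType.
Notation upoly := (upoly R).
Context {T : Type} {ET : Enc R T}.

Lemma comp_reduce1 (w u : T -> upoly) :
  computable w -> computable u -> computable (fun x => reduce1 (w x) (u x)).
Proof.
move=> Hw Hu; have -> : (fun x => reduce1 (w x) (u x)) = (fun x =>
    if nilp (u x) then [::] else if nilp (w x) then [::] else
    cross_combine (head [::] (w x)) (head [::] (u x)) (behead (u x)) (behead (w x))).
  by apply/funext => x; case: (u x) => // ? ?; case: (w x).
comp.
Qed.

End CompReduction.

#[global] Hint Extern 1 (computable _) =>
  lazymatch goal with
  | |- computable (fun x => reduce1 _ _) => simple apply comp_reduce1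
  end : comp.

Section CompRemainder.
Variable R : realType.
Notation upoly := (upoly R).
Context {T : Type} {ET : Enc R T}.

Lemma comp_pseudo_rem (u w : T -> upoly) :
  computable u -> computable w -> computable (fun x => pseudo_rem (u x) (w x)).
Proof. by move=> Hu Hw; rewrite /pseudo_rem; comp. Qed.

End CompRemainder.

#[global] Hint Extern 1 (computable _) =>
  lazymatch goal with
  | |- computable (fun x => pseudo_rem _ _) => simple apply comp_pseudo_rem
  end : comp.

Section CompElimination.
Variable R : realType.
Notation mpoly := (mpoly R).
Notation upoly := (upoly R).
Notation row := (seq R).
Notation table := (row * seq (row * row))%type.
Context {T : Type} {ET : Enc R T}.

Lemma comp_elimination_set (L : T -> seq mpoly) :
  computable L -> computable (fun x => elimination_set (L x)).
Proof.
move=> HL; rewrite /elimination_set /derived_closure /derived_step /remainders.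
rewrite /total_size /univariates; comp.
Qed.

Lemma comp_strip (sg : T -> mpoly -> R) (u : T -> upoly) :
  computable (fun t : T * mpoly => sg t.1 t.2) -> computable u ->
  computable (fun x => strip (sg x) (u x)).
Proof.
move=> Hsg Hu; apply: (comp_list_iter (F0 := fun=> [::])
  (F1 := fun x c u r => if sg x c == 0 then r else c :: u)
  (f := fun x u => strip (sg x) u)) => //; comp.
Qed.

Lemma comp_vanishing (P : T -> seq upoly) (r : T -> row) :
  computable P -> computable r -> computable (fun x => vanishing (P x) (r x)).
Proof.
apply: (@comp_rec _ _ upoly row _ _ _ _ _ (fun _ _ => [::])
  (fun x q _ r b => if head 1 r == 0 then q else b)
  (fun _ _ r => behead r) (fun _ P r => vanishing P r)) => //; comp.
Qed.

Lemma comp_cut (sa sb : T -> R) (r0 : T -> row) (rest : T -> seq (row * row)) :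
  computable sa -> computable sb -> computable r0 -> computable rest ->
  computable (fun x => cut (sa x) (sb x) (r0 x) (rest x)).
Proof. by move=> Ha Hb H0 Hrest; rewrite /cut; comp. Qed.

Lemma comp_rows (t : T -> table) : computable t -> computable (fun x => rows (t x)).
Proof. by move=> Ht; rewrite /rows; comp. Qed.

End CompElimination.

#[global] Hint Extern 1 (computable _) =>
  lazymatch goal with
  | |- computable (fun x => elimination_set _) => simple apply comp_elimination_set
  | |- computable (fun x => strip _ _) => simple apply comp_strip
  | |- computable (fun x => vanishing _ _) => simple apply comp_vanishing
  | |- computable (fun x => cut _ _ _ _) => simple apply comp_cut
  | |- computable (fun x => rows _) => simple apply comp_rows
  end : comp.

Section CompRows.
Variable R : realType.
Notation mpoly := (mpoly R).
Notation upoly := (upoly R).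
Notation row := (seq R).
Context {T : Type} {ET : Enc R T}.

Lemma comp_insert (st : T -> row -> R) (sinf : T -> R) (rest : T -> seq (row * row))
    (t : T -> R * row) :
  computable (fun t : T * row => st t.1 t.2) -> computable sinf ->
  computable rest -> computable t ->
  computable (fun x => insert (st x) (sinf x) (rest x) (t x)).
Proof.
move=> Hst Hinf Hrest Ht.
apply: (@comp_rec _ _ (row * row)%type (R * row)%type _ _ _ _ _
  (fun x t => cut t.1 (sinf x) t.2 [::])
  (fun x sr _ t b => cut t.1 (st x sr.1) t.2 ((st x sr.1 :: sr.1, b.1) :: b.2))
  (fun x sr _ => (st x sr.1, sr.2))
  (fun x rest t => insert (st x) (sinf x) rest t)) => //; comp.
Qed.

Lemma comp_by_size (sg : T -> mpoly -> R) (C : T -> seq upoly) (n : T -> nat) :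
  computable (fun t : T * mpoly => sg t.1 t.2) -> computable C -> computable n ->
  computable (fun x => by_size (sg x) (C x) (n x)).
Proof.
move=> Hsg HC Hn; apply: (@comp_nat_rec _ _ _ unit _ _ _ (fun _ _ => [::])
  (fun x n _ b => [seq u <- C x | (size u == n.+1) && (sg x (head [::] u) != 0)] ++ b)
  (fun _ s => s) (fun x n _ => by_size (sg x) (C x) n) n (fun=> tt)) => //; comp.
Qed.

Lemma comp_sign_row (sg : T -> mpoly -> R) (P : T -> seq upoly) (r : T -> row)
    (u : T -> upoly) :
  computable (fun t : T * mpoly => sg t.1 t.2) -> computable P -> computable r ->
  computable u -> computable (fun x => sign_row (sg x) (P x) (r x) (u x)).
Proof. by move=> Hsg HP Hr Hu; rewrite /sign_row; comp. Qed.

End CompRows.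

#[global] Hint Extern 1 (computable _) =>
  lazymatch goal with
  | |- computable (fun x => insert _ _ _ _) => simple apply comp_insert
  | |- computable (fun x => by_size _ _ _) => simple apply comp_by_size
  | |- computable (fun x => sign_row _ _ _ _) => simple apply comp_sign_row
  end : comp.

Section CompSignTable.
Variable R : realType.
Notation mpoly := (mpoly R).
Notation upoly := (upoly R).
Context {T : Type} {ET : Enc R T}.

Lemma comp_sign_table (sg : T -> mpoly -> R) (C : T -> seq upoly) (n : T -> nat) :
  computable (fun t : T * mpoly => sg t.1 t.2) -> computable C -> computable n ->
  computable (fun x => sign_table (sg x) (C x) (n x)).
Proof.
move=> Hsg HC Hn; rewrite /sign_table /extend_table /sign_root; comp.
Qed.

End CompSignTable.

#[global] Hint Extern 1 (computable _) =>
  lazymatch goal with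
  | |- computable (fun x => sign_table _ _ _) => simple apply comp_sign_table
  end : comp.

Section CompFibers.
Variable R : realType.
Notation mpoly := (mpoly R).
Notation row := (seq R).
Context {T : Type} {ET : Enc R T}.

Lemma comp_fiber_vectors (L : T -> seq mpoly) (v : T -> row) :
  computable L -> computable v -> computable (fun x => fiber_vectors (L x) (v x)).
Proof.
move=> HL Hv; rewrite /fiber_vectors /project /total_size /univariates; comp.
Qed.

End CompFibers.

#[global] Hint Extern 1 (computable _) =>
  lazymatch goal with
  | |- computable (fun x => fiber_vectors _ _) => simple apply comp_fiber_vectors
  end : comp.

Section CompSystems.
Variable R : realType.
Notation mpoly := (mpoly R).
Context {T : Type} {ET : Enc R T}.

Lemma comp_sign_vectors (N : T -> nat) (L : T -> seq mpoly) :
  computable N -> computable L -> computable (fun x => sign_vectors (N x) (L x)).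
Proof.
move=> HN HL; apply: (@comp_nat_rec _ _ _ (seq mpoly) _ _ _
  (fun _ L => [:: [seq Num.sg (constant_term p) | p <- L]])
  (fun _ _ L V => flatten [seq fiber_vectors L v | v <- V])
  (fun _ L => project L) (fun _ N L => sign_vectors N L)) => //;
  rewrite /constant_term /project; comp.
Qed.

Lemma comp_tree_fold (w : T -> seq bool) (t : T -> tree) :
  computable w -> computable t -> computable (fun x => tree_fold (w x) (t x)).
Proof.
move=> Hw Ht; apply: (@comp_tree_rec _ T tree_data _ _ (fun=> (false, ([::], [::])))
  (fun x d1 d2 => tree_data_cons (w x) d1 d2) (fun x t => tree_fold (w x) t)) => //.
  comp.
rewrite /tree_data_cons /tree_connective; comp.
Qed.

Lemma comp_valuations (n : T -> nat) :
  computable n -> computable (fun x => valuations (n x)).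
Proof.
move=> Hn; apply: (@comp_nat_rec _ _ _ unit _ _ _ (fun _ _ => [:: [::]])
  (fun _ _ _ ws => map (cons true) ws ++ map (cons false) ws)
  (fun _ s => s) (fun _ n _ => valuations n) n (fun=> tt)) => //; comp.
Qed.

Lemma comp_event_poly (b : T -> seq bool -> bool) (ws : T -> seq (seq bool))
    (e : T -> seq nat) :
  computable (fun t : T * seq bool => b t.1 t.2) -> computable ws -> computable e ->
  computable (fun x => event_poly R (b x) (ws x) (e x)).
Proof.
move=> Hb Hws He; apply: (@comp_rec _ _ (seq bool) (seq nat) _ _ _ _ _
  (fun _ _ => [::])
  (fun x w _ e p => if b x w then (1, e) :: p else p)
  (fun _ _ e => 0%N :: e) (fun x ws e => event_poly R (b x) ws e)) => //; comp.
Qed.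

Lemma comp_atom_polys (ws : T -> seq (seq bool)) (e : T -> seq nat) :
  computable ws -> computable e ->
  computable (fun x => atom_polys R (ws x) (e x)).
Proof.
move=> Hws He; apply: (@comp_rec _ _ (seq bool) (seq nat) _ _ _ _ _
  (fun _ _ => [::]) (fun x w _ e ps => [:: (1, e)] :: ps)
  (fun _ _ e => 0%N :: e) (fun x ws e => atom_polys R ws e)) => //; comp.
Qed.

Lemma comp_mpoly_exp (p : T -> mpoly) (k : T -> nat) :
  computable p -> computable k -> computable (fun x => mpoly_exp (p x) (k x)).
Proof. by move=> Hp Hk; rewrite /mpoly_exp; comp. Qed.

Lemma comp_signs_hold (ks : T -> seq nat) (v : T -> seq R) :
  computable ks -> computable v -> computable (fun x => signs_hold (ks x) (v x)).
Proof.
move=> Hks Hv; apply: (@comp_rec _ _ nat (seq R) _ _ _ _ _ (fun _ _ => true)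
  (fun _ k _ v b => sign_holds k (head 0 v) && b)
  (fun _ _ v => behead v) (fun _ ks v => signs_hold ks v)) => //;
  rewrite /sign_holds; comp.
Qed.

End CompSystems.

#[global] Hint Extern 1 (computable _) =>
  lazymatch goal with
  | |- computable (fun x => sign_vectors _ _) => simple apply comp_sign_vectors
  | |- computable (fun x => tree_fold _ _) => simple apply comp_tree_fold
  | |- computable (fun x => valuations _) => simple apply comp_valuations
  | |- computable (fun x => event_poly _ _ _ _) => simple apply comp_event_poly
  | |- computable (fun x => atom_polys _ _ _) => simple apply comp_atom_polys
  | |- computable (fun x => mpoly_exp _ _) => simple apply comp_mpoly_exp
  | |- computable (fun x => signs_hold _ _) => simple apply comp_signs_hold
  end : comp.

Lemma comp_monomial_subst (R : realType) T (ET : Enc R T)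
    (ps : T -> seq (mpoly R)) (e : T -> seq nat) :
  computable ps -> computable e ->
  computable (fun x => monomial_subst (ps x) (e x)).
Proof.
move=> Hps He; apply: (@comp_rec _ _ (mpoly R) (seq nat) _ _ _ _ _
  (fun _ _ => [:: (1, [::])])
  (fun _ p _ e q => mpoly_mul (mpoly_exp p (head 0%N e)) q)
  (fun _ _ e => behead e) (fun _ ps e => monomial_subst ps e)) => //; comp.
Qed.

#[global] Hint Extern 1 (computable _) =>
  lazymatch goal with
  | |- computable (fun x => monomial_subst _ _) => simple apply comp_monomial_subst
  end : comp.

Lemma comp_decide (R : realType) : computable (@decide R).
Proof.
rewrite /decide /system /mpoly_subst /atoms_of /tree_eval; comp.
Qed.

(** * Agreement of the encodings, and the conclusion *)

Lemma enc_list_value (R : realType) A (EA : Enc R A) (s : seq A) :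
  enc_list EA s = list_value (map EA s).
Proof. by elim: s => //= x s ->. Qed.

Lemma enc_raw_of (R : realType) (E : pre_environment R) :
  enc (raw_of E) = pre_environment_value E.
Proof.
have enc_nat_list (s : seq nat) : enc s = list_value (map (@nat_value R) s).
  exact: enc_list_value.
have enc_tree_nat k : enc_tree R (tree_nat k) = nat_value k.
  by rewrite /nat_value /tree_nat; elim: k => //= k ->.
have enc_comb n (B : boolean_combination n) :
    enc_tree R (tree_of_combination B) = combination_value R B.
  elim: B => [i|B1 IH1|B1 IH1 B2 IH2|B1 IH1 B2 IH2||] /=;
    by rewrite ?enc_tree_nat ?IH1 ?IH2.
rewrite /pre_environment_value /raw_of /enc /Enc_prod /=.
congr (VCons _ (VCons _ (VCons _ (VCons _ (VCons _ _))))).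
- rewrite /enc /Enc_seq enc_list_value -map_comp; congr list_value.
  by apply: eq_map => j; apply: enc_comb.
- rewrite /enc /Enc_seq enc_list_value -map_comp; congr list_value.
  apply: eq_map => r; rewrite /= /requirement_value; congr VCons.
    by case: req_relation.
  rewrite /= /enc /Enc_seq enc_list_value -map_comp; congr list_value.
  apply: eq_map => rho; congr VCons.
  by rewrite /= /enc enc_list_value -map_comp.
Qed.

Theorem corollary3p2 (R : realType) :
  decidable_problem (@pre_environment_value R) (@consistent R).
Proof.
have [p Hp] := comp_decide R; exists p => E; exists (decide (raw_of E)).
split; first exact: consistentP.
(* With empty remaining code, stack and frames, the state reached is a halted one holding only the
   result. *)
have [m Hm] := Hp (raw_of E) [::] [::] [::] [::].
rewrite cats0 in Hm; exists m, [:: pre_environment_value E].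
by rewrite -enc_raw_of.
Qed.
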